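(* The following problem is undecidable: given an entailment problem $(\phi,\psi,\mathcal R)$ such that $\mathcal R$ is progressing for $\phi$ and for $\psi$, connected for $\phi$, and established for $\phi$ and for $\psi$, decide whether $\phi\models_{\mathcal R}\psi$.
   Context: Fix $\kappa\in\mathbb N$. $\mathcal V$ is a countably infinite set of variables and $\bot$ a special constant; a term is a variable or $\bot$. Each predicate symbol $p$ has an arity $\mathrm{ar}(p)$. Formulas are given by $\phi ::= x\not\approx x' \mid x\approx x' \mid x\mapsto(y_1,\dots,y_\kappa)\mid p(x_1,\dots,x_n)\mid \phi_1*\phi_2\mid\phi_1\vee\phi_2\mid \exists x.\,\phi_1$, where $x,x',x_i$ are variables, the $y_i$ are terms, and $n=\mathrm{ar}(p)$. $\mathrm{fv}(\phi)$ denotes the free variables. A symbolic heap is a formula $\exists\vec x.\,\alpha_1*\dots*\alpha_m$ with atoms $\alpha_i$; it is predicate-less if it contains no predicate atom. A variable $x$ is allocated by a symbolic heap $\phi$ iff $\phi$ contains equalities $x_1\approx x_2,\dots,x_{n-1}\approx x_n$ ($n\ge 1$) with $x=x_1$ and a points-to atom $x_n\mapsto(\dots)$. An SID $\mathcal R$ is a finite set of rules $p(x_1,\dots,x_n)\Leftarrow\pi$ with $x_1,\dots,x_n$ pairwise distinct and $\pi$ a quantifier-free symbolic heap; the variables in $\mathrm{fv}(\pi)\setminus\{x_1,\dots,x_n\}$ are the existential variables of the rule. Write $p\succeq q$ iff some rule with head $p$ contains $q$ in its body; $\mathcal P(\phi)$ is the set of $q$ with $p\succeq^* q$ for some $p$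 occurring in $\phi$. $\phi\Leftarrow_{\mathcal R}\psi$ iff $\psi$ is obtained from $\phi$ by replacing a predicate atom $p(u_1,\dots,u_n)$ by $\pi[x_1/u_1,\dots,x_n/u_n]$ for some rule $p(x_1,\dots,x_n)\Leftarrow\pi$ of $\mathcal R$ (existential variables renamed to fresh ones); an unfolding of $\phi$ is any $\psi$ with $\phi\Leftarrow_{\mathcal R}^*\psi$. Semantics: $\mathcal L$ is a countably infinite set of locations containing $\ell_\bot$; a store is a partial map $s:\mathcal V\cup\{\bot\}\to\mathcal L$ with $\bot\in\mathrm{dom}(s)$ and $s(x)=\ell_\bot$ iff $x=\bot$; a heap is a finite partial map $h:\mathcal L\to\mathcal L^\kappa$ with $\ell_\bot\notin\mathrm{dom}(h)$. $(s,h)\models_{\mathcal R}\phi$ is the least relation such that $\mathrm{fv}(\phi)\subseteq\mathrm{dom}(s)$ and: equalities/disequalities hold iff $\mathrm{dom}(h)=\emptyset$ and $s(x)=s(x')$ (resp. $\neq$); $x\mapsto(y_1,\dots,y_\kappa)$ holds iff $\mathrm{dom}(h)=\{s(x)\}$ and $h(s(x))=(s(y_1),\dots,s(y_\kappa))$; $\phi_1*\phi_2$ holds iff $h$ splits into two domain-disjoint heaps satisfying $\phi_1,\phi_2$; $\vee$ and $\exists$ as usual; $p(u_1,\dots,u_n)$ holds iff for some rule $p(x_1,\dots,x_n)\Leftarrow\pi$ and some extension $s'$ of $s$ to the existential variables, $(s',h)\models\pi[x_1/u_1,\dots,x_n/u_n]$. $\phi\models_{\mathcal R}\psi$ iff every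 model of $\phi$ is a model of $\psi$. An entailment problem is a triple $(\phi,\psi,\mathcal R)$ with $\phi$ quantifier-free. A rule $p(x_1,\dots,x_n)\Leftarrow\pi$ is progressing iff $\pi=x_1\mapsto(y_1,\dots,y_\kappa)*\rho$ with $\rho$ free of points-to atoms; connected iff it is progressing and every predicate atom in $\rho$ has the form $q(y_i,\vec u)$ for some $i\in\{1,\dots,\kappa\}$; established iff every existential variable of the rule is allocated by every predicate-less unfolding of $\pi$. $\mathcal R$ is progressing (connected, established) for a formula $\phi$ iff every rule of $\mathcal R$ with head predicate in $\mathcal P(\phi)$ is progressing (connected, established).
   Formalization: The theorem is proved for every κ ≥ 2 rather than every κ in ℕ: for κ = 0 (no predicate atoms in connected rules) and κ = 1 (models of φ are boundedly many lists, determined by their lengths) the problem is decidable, so the claim fails there. *)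

(* Defs.v *)
From Stdlib Require Import List Arith PeanoNat Permutation Relations.
Import ListNotations.

Definition var := nat.

Inductive term : Type := TVar (x : var) | TBot.

Definition psym := (nat * nat)%type.
Definition ar (p : psym) : nat := snd p.

Inductive atom : Type :=
| ANeq (x x' : var)
| AEq (x x' : var)
| APto (x : var) (ys : list term)
| APred (p : psym) (xs : list var).

Inductive form : Type :=
| FAtom (a : atom)
| FStar (f g : form)
| FOr (f g : form)
| FEx (x : var) (f : form).

(* a rule p(x_1..x_n) <= pi, with pi = a_1 * ... * a_m (m >= 1) a
   quantifier-free symbolic heap, given by its (nonempty) list of atoms *)
Record rule : Type := mkRule {
  rhead : psym;
  rparams : list var;
  rfirst : atom;
  rrest : list atom }.

Definition rbody (r : rule) : list atom := rfirst r :: rrest r.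

Definition sid := list rule.

Fixpoint star_of (a : atom) (l : list atom) : form :=
  match l with
  | [] => FAtom a
  | b :: l' => FStar (FAtom a) (star_of b l')
  end.

Definition rbody_form (r : rule) : form := star_of (rfirst r) (rrest r).

Definition fv_term (t : term) : list var :=
  match t with TVar x => [x] | TBot => [] end.

Definition fv_atom (a : atom) : list var :=
  match a with
  | ANeq x y => [x; y]
  | AEq x y => [x; y]
  | APto x ys => x :: flat_map fv_term ys
  | APred _ xs => xs
  end.

Fixpoint fv_form (f : form) : list var :=
  match f with
  | FAtom a => fv_atom a
  | FStar f g => fv_form f ++ fv_form g
  | FOr f g => fv_form f ++ fv_form g
  | FEx x f => remove Nat.eq_dec x (fv_form f)
  end.

Definition vars_atoms (A : list atom) : list var := flat_map fv_atom A.

Fixpoint qfree (f : form) : Prop :=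
  match f with
  | FAtom _ => True
  | FStar f g => qfree f /\ qfree g
  | FOr f g => qfree f /\ qfree g
  | FEx _ _ => False
  end.

Definition wf_atom (kappa : nat) (a : atom) : Prop :=
  match a with
  | APto _ ys => length ys = kappa
  | APred p xs => length xs = ar p
  | _ => True
  end.

Fixpoint wf_form (kappa : nat) (f : form) : Prop :=
  match f with
  | FAtom a => wf_atom kappa a
  | FStar f g => wf_form kappa f /\ wf_form kappa g
  | FOr f g => wf_form kappa f /\ wf_form kappa g
  | FEx _ f => wf_form kappa f
  end.

Definition wf_rule (kappa : nat) (r : rule) : Prop :=
  NoDup (rparams r) /\ length (rparams r) = ar (rhead r) /\
  Forall (wf_atom kappa) (rbody r).

Definition wf_sid (kappa : nat) (R : sid) : Prop := Forall (wf_rule kappa) R.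

Definition loc := nat.
Definition lbot : loc := 0.

Definition store := var -> option loc.
Definition valid_store (s : store) : Prop :=
  forall x l, s x = Some l -> l <> lbot.

Definition eval_term (s : store) (t : term) : option loc :=
  match t with TVar x => s x | TBot => Some lbot end.

Definition update (s : store) (x : var) (l : loc) : store :=
  fun y => if Nat.eqb y x then Some l else s y.

Definition defined (s : store) (xs : list var) : Prop :=
  forall x, In x xs -> exists l, s x = Some l.

Definition heap := loc -> option (list loc).

Definition valid_heap (kappa : nat) (h : heap) : Prop :=
  h lbot = None /\
  (exists n, forall l, n <= l -> h l = None) /\
  (forall l v, h l = Some v -> length v = kappa).

Definition hemp (h : heap) : Prop := forall l, h l = None.

Definition hsingle (a : loc) (v : list loc) (h : heap) : Prop :=
  forall l, h l = (if Nat.eqb l a then Some v else None).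

Definition hunion (h1 h2 h : heap) : Prop :=
  forall l, (h1 l = None \/ h2 l = None) /\
            h l = match h1 l with Some v => Some v | None => h2 l end.

(* the least satisfaction relation (s,h) |=_R phi.  For a predicate atom,
   the store t interprets the rule body: it maps the formal parameters to the
   values of the actual arguments and the existential variables of the rule
   to arbitrary locations (this is the extension of s to the (freshly
   renamed) existential variables of pi[x_1/u_1,...,x_n/u_n]). *)
Inductive sat (R : sid) : store -> heap -> form -> Prop :=
| sat_neq s h x x' a b :
    s x = Some a -> s x' = Some b -> a <> b -> hemp h ->
    sat R s h (FAtom (ANeq x x'))
| sat_eq s h x x' a :
    s x = Some a -> s x' = Some a -> hemp h ->
    sat R s h (FAtom (AEq x x'))
| sat_pto s h x ys a vs :
    s x = Some a -> map (eval_term s) ys = map Some vs -> hsingle a vs h ->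
    sat R s h (FAtom (APto x ys))
| sat_pred s h p us ls r t :
    map s us = map Some ls ->
    In r R -> rhead r = p ->
    valid_store t -> map t (rparams r) = map Some ls ->
    sat R t h (rbody_form r) ->
    sat R s h (FAtom (APred p us))
| sat_star s h h1 h2 f g :
    hunion h1 h2 h -> sat R s h1 f -> sat R s h2 g ->
    sat R s h (FStar f g)
| sat_orl s h f g :
    sat R s h f -> defined s (fv_form g) -> sat R s h (FOr f g)
| sat_orr s h f g :
    sat R s h g -> defined s (fv_form f) -> sat R s h (FOr f g)
| sat_ex s h x f l :
    l <> lbot -> sat R (update s x l) h f -> sat R s h (FEx x f).

Definition entails (kappa : nat) (R : sid) (phi psi : form) : Prop :=
  forall s h, valid_store s -> valid_heap kappa h ->
    sat R s h phi -> sat R s h psi.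

Fixpoint preds_form (f : form) : list psym :=
  match f with
  | FAtom (APred p _) => [p]
  | FAtom _ => []
  | FStar f g => preds_form f ++ preds_form g
  | FOr f g => preds_form f ++ preds_form g
  | FEx _ f => preds_form f
  end.

Definition succ_pred (R : sid) (p q : psym) : Prop :=
  exists r xs, In r R /\ rhead r = p /\ In (APred q xs) (rbody r).

Definition in_P (R : sid) (phi : form) (q : psym) : Prop :=
  exists p, In p (preds_form phi) /\ clos_refl_trans psym (succ_pred R) p q.

Definition is_pto (a : atom) : Prop :=
  match a with APto _ _ => True | _ => False end.

(* pi = x_1 |-> (y_1..y_kappa) * rho, rho free of points-to atoms
   (pi taken modulo associativity/commutativity of * ) *)
Definition progressing (r : rule) : Prop :=
  exists x1 xs ys rho,
    rparams r = x1 :: xs /\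
    Permutation (rbody r) (APto x1 ys :: rho) /\
    (forall a, In a rho -> ~ is_pto a).

Definition connected (r : rule) : Prop :=
  exists x1 xs ys rho,
    rparams r = x1 :: xs /\
    Permutation (rbody r) (APto x1 ys :: rho) /\
    (forall a, In a rho -> ~ is_pto a) /\
    (forall q us, In (APred q us) rho ->
       exists u us', us = u :: us' /\ In (TVar u) ys).

Definition existential (r : rule) (x : var) : Prop :=
  In x (vars_atoms (rbody r)) /\ ~ In x (rparams r).

Definition rename_term (sg : var -> var) (t : term) : term :=
  match t with TVar x => TVar (sg x) | TBot => TBot end.

Definition rename_atom (sg : var -> var) (a : atom) : atom :=
  match a with
  | ANeq x y => ANeq (sg x) (sg y)
  | AEq x y => AEq (sg x) (sg y)
  | APto x ys => APto (sg x) (map (rename_term sg) ys)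
  | APred p xs => APred p (map sg xs)
  end.

(* one unfolding step on a quantifier-free symbolic heap a_1 * ... * a_m:
   replace a predicate atom p(u_1..u_n) by pi[x_1/u_1,...,x_n/u_n] with the
   existential variables renamed to pairwise distinct fresh variables *)
Definition unfold_step (R : sid) (A B : list atom) : Prop :=
  exists A1 A2 p us r (sg : var -> var),
    A = A1 ++ APred p us :: A2 /\
    In r R /\ rhead r = p /\
    map sg (rparams r) = us /\
    (forall e, existential r e -> ~ In (sg e) (vars_atoms A)) /\
    (forall e e', existential r e -> existential r e' -> sg e = sg e' -> e = e') /\
    B = A1 ++ map (rename_atom sg) (rbody r) ++ A2.

Definition unfolds (R : sid) : list atom -> list atom -> Prop :=
  clos_refl_trans (list atom) (unfold_step R).

Definition predicate_less (A : list atom) : Prop :=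
  forall p xs, ~ In (APred p xs) A.

Inductive allocated (A : list atom) : var -> Prop :=
| alloc_pto x ys : In (APto x ys) A -> allocated A x
| alloc_eq x y : In (AEq x y) A -> allocated A y -> allocated A x.

Definition established (R : sid) (r : rule) : Prop :=
  forall B, unfolds R (rbody r) B -> predicate_less B ->
    forall e, existential r e -> allocated B e.

Definition progressing_for (R : sid) (phi : form) : Prop :=
  forall r, In r R -> in_P R phi (rhead r) -> progressing r.
Definition connected_for (R : sid) (phi : form) : Prop :=
  forall r, In r R -> in_P R phi (rhead r) -> connected r.
Definition established_for (R : sid) (phi : form) : Prop :=
  forall r, In r R -> in_P R phi (rhead r) -> established R r.

Definition restricted_instance (kappa : nat) (phi psi : form) (R : sid) : Prop :=
  wf_form kappa phi /\ wf_form kappa psi /\ wf_sid kappa R /\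
  qfree phi /\
  progressing_for R phi /\ progressing_for R psi /\
  connected_for R phi /\
  established_for R phi /\ established_for R psi.

(* Cantor pairing (a bijection nat * nat -> nat) *)
Definition cpair (x y : nat) : nat := (x + y) * (x + y + 1) / 2 + y.

Inductive rprog : Type :=
| RZero | RSucc | RId | RFst | RSnd
| RPair (f g : rprog)
| RComp (f g : rprog)
| RPrec (f g : rprog)
| RMu (f : rprog).

Inductive reval : rprog -> nat -> nat -> Prop :=
| ev_zero x : reval RZero x 0
| ev_succ x : reval RSucc x (S x)
| ev_id x : reval RId x x
| ev_fst x y : reval RFst (cpair x y) x
| ev_snd x y : reval RSnd (cpair x y) y
| ev_pair f g x a b : reval f x a -> reval g x b -> reval (RPair f g) x (cpair a b)
| ev_comp f g x y z : reval g x y -> reval f y z -> reval (RComp f g) x z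
| ev_prec0 f g x v : reval f x v -> reval (RPrec f g) (cpair x 0) v
| ev_precS f g x n w v :
    reval (RPrec f g) (cpair x n) w -> reval g (cpair x (cpair n w)) v ->
    reval (RPrec f g) (cpair x (S n)) v
| ev_mu f x n :
    reval f (cpair x n) 0 ->
    (forall m, m < n -> exists k, reval f (cpair x m) (S k)) ->
    reval (RMu f) x n.

Definition enc_list {A : Type} (e : A -> nat) (l : list A) : nat :=
  fold_right (fun a acc => S (cpair (e a) acc)) 0 l.

Definition enc_term (t : term) : nat :=
  match t with TVar x => cpair 0 x | TBot => cpair 1 0 end.

Definition enc_psym (p : psym) : nat := cpair (fst p) (snd p).

Definition enc_atom (a : atom) : nat :=
  match a with
  | ANeq x y => cpair 0 (cpair x y)
  | AEq x y => cpair 1 (cpair x y)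
  | APto x ys => cpair 2 (cpair x (enc_list enc_term ys))
  | APred p xs => cpair 3 (cpair (enc_psym p) (enc_list (fun x => x) xs))
  end.

Fixpoint enc_form (f : form) : nat :=
  match f with
  | FAtom a => cpair 0 (enc_atom a)
  | FStar f g => cpair 1 (cpair (enc_form f) (enc_form g))
  | FOr f g => cpair 2 (cpair (enc_form f) (enc_form g))
  | FEx x f => cpair 3 (cpair x (enc_form f))
  end.

Definition enc_rule (r : rule) : nat :=
  cpair (enc_psym (rhead r))
        (cpair (enc_list (fun x => x) (rparams r)) (enc_list enc_atom (rbody r))).

Definition enc_problem (phi psi : form) (R : sid) : nat :=
  cpair (enc_form phi) (cpair (enc_form psi) (enc_list enc_rule R)).

Definition decides_restricted_entailment (kappa : nat) (P : rprog) : Prop :=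
  forall phi psi R, restricted_instance kappa phi psi R ->
    (entails kappa R phi psi -> reval P (enc_problem phi psi R) 1) /\
    (~ entails kappa R phi psi -> reval P (enc_problem phi psi R) 0).

(* Main.v *)
Require Import Defs.
From Stdlib Require Import List Arith PeanoNat Lia Permutation Relations Cantor.
From Stdlib Require Import FunctionalExtensionality Classical.
Import ListNotations.

(* Given a program P that decides the problem, let f(q) be the answer of P on the
   entailment problem that the code q describes when instantiated with the input
   q itself.  Compile f to a counter machine.  The runs of the machine are words,
   and a word is stored in a heap as a list whose cells carry a pointer to the
   next cell and a location that stands for a letter.  The formula phi generates
   all words that begin with the initial configuration for the given input; psi
   says that the word contains an error, so the entailment holds iff the machine
   does not accept the input.  Everything psi has to detect is regular, except that
   the number of occurrences of a letter is wrong in two consecutive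
   configurations.  To compare them, a rule that is not connected guesses the
   location from which the second head starts, and the two heads then read in
   parallel; the guess is right because the left head must end on a pointer to it,
   and it is allocated because the right head reads it, so the rules are
   established.  For q the code of the problem of this machine itself, the answer
   of P is wrong. *)

(** A separating conjunction reads every cell exactly once, and psi has to use up the whole heap. An
    error must therefore be found in a single pass: the two heads read disjoint adjacent stretches,
    one register is compared at a time, and whatever follows the error is still consumed. No formula
    forces the letters to have distinct locations. If the machine does not accept, the word
    generated by phi satisfies psi under the same interpretation of the letters, injective or not;
    if it accepts, one model with distinct letters refutes the entailment. Compilation is verified
    in one direction only: an evaluation yields a run. That a machine with answer 0 has no accepting
    run comes from determinism. The self-application is not circular: the program that builds the
    code of the instance has q as its input and does not mention the machine, so the machine is
    fixed before q is. *)

(** * The Cantor pairing *)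

Lemma cpair_to_nat x y : cpair x y = Cantor.to_nat (x, y).
Proof.
  unfold cpair. pose proof (Cantor.to_nat_spec x y) as H.
  replace ((x + y) * (x + y + 1)) with ((Cantor.to_nat (x, y) - y) * 2) by nia.
  rewrite Nat.div_mul by lia. nia.
Qed.

Lemma cpair_inj x y x' y' : cpair x y = cpair x' y' -> x = x' /\ y = y'.
Proof.
  rewrite !cpair_to_nat. intros H.
  apply (f_equal Cantor.of_nat) in H. rewrite !Cantor.cancel_of_to in H.
  now inversion H.
Qed.

Lemma cpair_ge_l x y : x <= cpair x y.
Proof. rewrite cpair_to_nat. pose proof (Cantor.to_nat_non_decreasing x y). lia. Qed.

(** One step along the diagonals of the Cantor enumeration. A counter program unpairs [z] by making
    [z] such steps from (0, 0). *)
Definition of_nat_step (p : nat * nat) : nat * nat :=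
  match p with (0, y) => (S y, 0) | (S x, y) => (x, S y) end.

Lemma of_nat_S n : Cantor.of_nat (S n) = of_nat_step (Cantor.of_nat n).
Proof.
  change (Cantor.of_nat (S n)) with
    (let '(x, y) := Cantor.of_nat n in match x with S i => (i, S y) | _ => (S y, 0) end).
  destruct (Cantor.of_nat n) as [[|x] y]; reflexivity.
Qed.

(** * Counter programs *)

Definition regs := nat -> nat.
Definition upd (s : regs) (r v : nat) : regs := fun x => if x =? r then v else s x.

Inductive cmd : Type :=
| CSkip
| CInc (r : nat)
| CSeq (c d : cmd)
| CWhile (r : nat) (c : cmd).

Inductive exec : cmd -> regs -> regs -> Prop :=
| ex_skip s : exec CSkip s s
| ex_inc s r : exec (CInc r) s (upd s r (S (s r)))
| ex_seq c d s s' s'' : exec c s s' -> exec d s' s'' -> exec (CSeq c d) s s''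
| ex_while0 r c s : s r = 0 -> exec (CWhile r c) s s
| ex_whileS r c s s' s'' n :
    s r = S n -> exec c (upd s r n) s' -> exec (CWhile r c) s' s'' ->
    exec (CWhile r c) s s''.

Lemma exec_eq c s s' s'' : exec c s s' -> s' = s'' -> exec c s s''.
Proof. now intros H <-. Qed.

(** A loop is described by its state as a function of the number of passes still to go. Most loops
    below supply such a closed form in place of an induction of their own. *)
Lemma exec_while_family r c (st : nat -> regs) n :
  (forall i, i < n -> exec c (upd (st (S i)) r i) (st i)) ->
  (forall i, i <= n -> st i r = i) ->
  exec (CWhile r c) (st n) (st 0).
Proof.
  intros H Hr. induction n as [|n IH].
  - apply ex_while0. now apply Hr.
  - eapply ex_whileS with (n := n); [now apply Hr | apply H; lia |].
    apply IH; intros; [apply H | apply Hr]; lia.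
Qed.

Ltac eqb_cases :=
  repeat match goal with
  | |- context [?a =? ?b] =>
      first [ rewrite (proj2 (Nat.eqb_neq a b)) by lia
            | rewrite (proj2 (Nat.eqb_eq a b)) by lia
            | destruct (Nat.eqb_spec a b); [subst a || subst b || idtac | ] ]
  end.

Ltac upd_simpl := unfold upd; eqb_cases.

Ltac regs_eq := apply functional_extensionality; intro; upd_simpl; try lia; auto with arith.

Definition clear r := CWhile r CSkip.
Definition move a b := CWhile a (CInc b).
Definition copy a b u := CSeq (CWhile a (CSeq (CInc b) (CInc u))) (move u a).

Lemma exec_clear r s : exec (clear r) s (upd s r 0).
Proof.
  eapply exec_eq.
  - replace s with (upd s r (s r)) at 1 by (regs_eq; congruence).
    apply (exec_while_family r CSkip (fun i => upd s r i)).
    + intros i _. eapply exec_eq; [constructor | regs_eq].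
    + intros. upd_simpl. reflexivity.
  - regs_eq.
Qed.

Lemma exec_move a b s : a <> b -> exec (move a b) s (upd (upd s b (s b + s a)) a 0).
Proof.
  intros Hab. eapply exec_eq.
  - replace s with (upd (upd s b (s b + s a - s a)) a (s a)) at 1 by (regs_eq; congruence).
    apply (exec_while_family a (CInc b) (fun i => upd (upd s b (s b + s a - i)) a i)).
    + intros i Hi. eapply exec_eq; [constructor | regs_eq].
    + intros. upd_simpl. reflexivity.
  - regs_eq.
Qed.

Lemma exec_copy a b u s :
  a <> b -> a <> u -> b <> u -> s u = 0 -> exec (copy a b u) s (upd s b (s b + s a)).
Proof.
  intros Hab Hau Hbu Hu. econstructor.
  - replace s with (upd (upd (upd s b (s b + s a - s a)) u (s a - s a)) a (s a)) at 1
      by (regs_eq; congruence).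
    apply (exec_while_family a _
      (fun i => upd (upd (upd s b (s b + s a - i)) u (s a - i)) a i)).
    + intros i Hi. econstructor; [constructor|]. eapply exec_eq; [constructor | regs_eq].
    + intros. upd_simpl. reflexivity.
  - eapply exec_eq; [apply exec_move; lia |]. regs_eq; congruence.
Qed.

(** The first loop leaves the sum in [a] and the old [b] in [o]. In the second, [copy] sees the
    counter already decremented, and [CInc] adds the missing 1, so the passes add up to the
    triangular number of the sum. *)
Definition pair_cmd a b o u :=
  CSeq (CWhile b (CSeq (CInc a) (CInc o))) (CWhile a (CSeq (copy a o u) (CInc o))).

Definition tri n := Cantor.to_nat (n, 0).

Lemma tri_S n : tri (S n) = S n + tri n.
Proof.
  unfold tri. pose proof (Cantor.to_nat_spec n 0). pose proof (Cantor.to_nat_spec (S n) 0). nia.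
Qed.

Lemma tri_mono m n : m <= n -> tri m <= tri n.
Proof. induction 1; [lia | rewrite tri_S; lia]. Qed.

Lemma cpair_tri x y : cpair x y = y + tri (x + y).
Proof.
  rewrite cpair_to_nat. unfold tri.
  pose proof (Cantor.to_nat_spec x y). pose proof (Cantor.to_nat_spec (x + y) 0). nia.
Qed.

Lemma exec_pair a b o u s :
  a <> b -> a <> o -> a <> u -> b <> o -> b <> u -> o <> u -> s o = 0 -> s u = 0 ->
  exec (pair_cmd a b o u) s (upd (upd (upd s a 0) b 0) o (cpair (s a) (s b))).
Proof.
  intros. econstructor.
  - replace s with (upd (upd (upd s a (s a + (s b - s b))) o (s b - s b)) b (s b)) at 1
      by (regs_eq; congruence).
    apply (exec_while_family b _
      (fun i => upd (upd (upd s a (s a + (s b - i))) o (s b - i)) b i)).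
    + intros i Hi. econstructor; [constructor|]. eapply exec_eq; [constructor | regs_eq].
    + intros. upd_simpl. reflexivity.
  - set (N := s a + s b).
    replace (upd (upd (upd s a _) o _) b 0)
      with (upd (upd (upd s b 0) o (s b + (tri N - tri N))) a N)
      by (subst N; regs_eq).
    eapply exec_eq.
    + apply (exec_while_family a _ (fun i => upd (upd (upd s b 0) o (s b + (tri N - tri i))) a i)).
      * intros i Hi. econstructor; [apply exec_copy; try lia; upd_simpl; lia|].
        eapply exec_eq; [constructor|].
        pose proof (tri_mono _ _ Hi). pose proof (tri_S i). regs_eq.
      * intros. upd_simpl. reflexivity.
    + rewrite cpair_tri. fold N. change (tri 0) with 0. regs_eq.
Qed.

(** Each pass performs [of_nat_step] on [a] and [b]. The loop on [a] is a conditional: moving [a] to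
    [v] makes it run at most once, and it clears the flag [u]. The loop on [u] is the else
    branch. *)
Definition unpair_cmd z a b u v :=
  CWhile z (CSeq (CInc u)
           (CSeq (CWhile a (CSeq (move a v) (CSeq (CInc b) (clear u))))
           (CSeq (move v a)
                 (CWhile u (CSeq (move b a) (CInc a)))))).

Definition set_pair (s : regs) a b (p : nat * nat) : regs := upd (upd s a (fst p)) b (snd p).

Lemma exec_unpair_step a b u v s p :
  NoDup [a; b; u; v] -> s u = 0 -> s v = 0 ->
  exec (CSeq (CInc u)
           (CSeq (CWhile a (CSeq (move a v) (CSeq (CInc b) (clear u))))
           (CSeq (move v a)
                 (CWhile u (CSeq (move b a) (CInc a))))))
       (set_pair s a b p) (set_pair s a b (of_nat_step p)).
Proof.
  intros Hnd Hu Hv.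
  assert (a <> b /\ a <> u /\ a <> v /\ b <> u /\ b <> v /\ u <> v) as (? & ? & ? & ? & ? & ?).
  { repeat match goal with H : NoDup (_ :: _) |- _ => inversion H; clear H; subst end.
    cbn in *. intuition. }
  destruct p as [[|x] y]; unfold set_pair, of_nat_step, fst, snd.
  - econstructor; [constructor|].
    econstructor; [apply ex_while0; upd_simpl; lia|].
    econstructor; [apply exec_move; lia|].
    eapply ex_whileS with (n := 0); [upd_simpl; lia | |].
    + econstructor; [apply exec_move; lia | constructor].
    + eapply exec_eq; [apply ex_while0; upd_simpl; lia | regs_eq].
  - econstructor; [constructor|].
    econstructor.
    { eapply ex_whileS with (n := x); [upd_simpl; lia | |].
      - econstructor; [apply exec_move; lia|].
        econstructor; [constructor | apply exec_clear].
      - apply ex_while0. upd_simpl; lia. }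
    econstructor; [apply exec_move; lia|].
    eapply exec_eq; [apply ex_while0; upd_simpl; lia | regs_eq].
Qed.

Lemma exec_unpair z a b u v s x y :
  NoDup [z; a; b; u; v] -> s z = cpair x y -> s a = 0 -> s b = 0 -> s u = 0 -> s v = 0 ->
  exec (unpair_cmd z a b u v) s (upd (upd (upd s z 0) a x) b y).
Proof.
  intros Hnd Hz Ha Hb Hu Hv. inversion Hnd as [|? ? Hin Hnd']; subst. cbn in Hin.
  assert (z <> a /\ z <> b /\ z <> u /\ z <> v) as (? & ? & ? & ?) by intuition.
  rewrite cpair_to_nat in Hz.
  set (n := s z) in *.
  assert (Hab : a <> b) by (inversion Hnd'; subst; cbn in *; intuition).
  eapply exec_eq.
  - replace s with (set_pair (upd s z n) a b (Cantor.of_nat (n - n))) at 1.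
    + apply (exec_while_family z _
        (fun i => set_pair (upd s z i) a b (Cantor.of_nat (n - i)))).
      * intros i Hi.
        replace (n - i) with (S (n - S i)) by lia. rewrite of_nat_S.
        eapply exec_eq.
        -- replace (upd (set_pair _ a b _) z i)
             with (set_pair (upd s z i) a b (Cantor.of_nat (n - S i))).
           ++ apply exec_unpair_step; [assumption | upd_simpl; lia | upd_simpl; lia].
           ++ unfold set_pair. regs_eq.
        -- reflexivity.
      * intros. unfold set_pair. upd_simpl. reflexivity.
    + rewrite Nat.sub_diag. unfold set_pair. cbn [Cantor.of_nat nat_rec nat_rect fst snd].
      subst n. regs_eq; congruence.
  - rewrite Nat.sub_0_r, Hz, Cantor.cancel_of_to. unfold set_pair, fst, snd. reflexivity.
Qed.

(** * Compiling programs to counters *)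

(* Input register [i] (consumed), output register [o] (initially zero), and
   registers from [t] on free for temporary use (zero before and after). *)
Fixpoint compile (f : rprog) (i o t : nat) : cmd :=
  match f with
  | RZero => clear i
  | RSucc => CSeq (move i o) (CInc o)
  | RId => move i o
  | RFst => CSeq (unpair_cmd i t (1 + t) (2 + t) (3 + t)) (CSeq (move t o) (clear (1 + t)))
  | RSnd => CSeq (unpair_cmd i t (1 + t) (2 + t) (3 + t)) (CSeq (move (1 + t) o) (clear t))
  | RPair f g =>
      CSeq (copy i t (1 + t))
      (CSeq (compile f i (1 + t) (2 + t))
      (CSeq (compile g t (2 + t) (3 + t))
            (pair_cmd (1 + t) (2 + t) o (3 + t))))
  | RComp f g => CSeq (compile g i t (1 + t)) (compile f t o (1 + t))
  | RPrec f g =>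
      CSeq (unpair_cmd i t (1 + t) (2 + t) (3 + t))
      (CSeq (copy t (2 + t) (3 + t))
      (CSeq (compile f (2 + t) (3 + t) (5 + t))
      (CSeq (CWhile (1 + t)
              (CSeq (copy t (5 + t) (6 + t))
              (CSeq (copy (4 + t) (6 + t) (7 + t))
              (CSeq (pair_cmd (6 + t) (3 + t) (7 + t) (8 + t))
              (CSeq (pair_cmd (5 + t) (7 + t) (8 + t) (9 + t))
              (CSeq (compile g (8 + t) (3 + t) (9 + t))
                    (CInc (4 + t))))))))
      (CSeq (move (3 + t) o)
      (CSeq (clear t) (clear (4 + t)))))))
  | RMu f =>
      CSeq (CInc (1 + t))
      (CSeq (CWhile (1 + t)
              (CSeq (copy i (2 + t) (3 + t))
              (CSeq (copy t (3 + t) (4 + t))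
              (CSeq (pair_cmd (2 + t) (3 + t) (4 + t) (5 + t))
              (CSeq (compile f (4 + t) (5 + t) (6 + t))
                    (CWhile (5 + t)
                      (CSeq (clear (5 + t)) (CSeq (CInc (1 + t)) (CInc t)))))))))
      (CSeq (clear i) (move t o)))
  end.

(** [w] is the whole history of the recursion; the closed form of the compiled loop needs the
    intermediate value at every pass. *)
Lemma reval_prec f g z v :
  reval (RPrec f g) z v ->
  exists x n w, z = cpair x n /\ reval f x (w 0) /\ w n = v /\
    forall k, k < n -> reval g (cpair x (cpair k (w k))) (w (S k)).
Proof.
  intros H. remember (RPrec f g) as p eqn:Hp. revert Hp.
  induction H; intros Hp; inversion Hp; subst.
  - exists x, 0, (fun _ => v). repeat split; [assumption|lia].
  - destruct (IHreval1 eq_refl) as (x' & n' & w' & Heq & Hw0 & Hn & Hk).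
    apply cpair_inj in Heq as [<- <-].
    exists x, (S n), (fun k => if k =? S n then v else w' k).
    split; [reflexivity|]. split; [exact Hw0|].
    split; [now rewrite Nat.eqb_refl|].
    intros k Hk'. rewrite (proj2 (Nat.eqb_neq k (S n))) by lia.
    destruct (Nat.eqb_spec (S k) (S n)) as [E|E].
    + injection E as ->. now subst.
    + apply Hk. lia.
Qed.

Lemma exec_inc_val r v s : s r = v -> exec (CInc r) s (upd s r (S v)).
Proof. intros <-. constructor. Qed.

Lemma exec_move_val a b v s :
  s a = v -> s b = 0 -> a <> b -> exec (move a b) s (upd (upd s b v) a 0).
Proof. intros <- Hb Hab. eapply exec_eq; [apply exec_move; assumption | now rewrite Hb]. Qed.

Lemma exec_copy_val a b u v s :
  s a = v -> s b = 0 -> s u = 0 -> NoDup [a; b; u] -> exec (copy a b u) s (upd s b v).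
Proof.
  intros <- Hb Hu Hnd. repeat rewrite NoDup_cons_iff in Hnd. cbn in Hnd.
  eapply exec_eq; [apply exec_copy; intuition | now rewrite Hb].
Qed.

Lemma exec_pair_val a b o u v w s :
  s a = v -> s b = w -> s o = 0 -> s u = 0 -> NoDup [a; b; o; u] ->
  exec (pair_cmd a b o u) s (upd (upd (upd s a 0) b 0) o (cpair v w)).
Proof.
  intros <- <- Ho Hu Hnd. repeat rewrite NoDup_cons_iff in Hnd. cbn in Hnd.
  apply exec_pair; intuition.
Qed.

Ltac nodup := match goal with |- NoDup _ => repeat constructor; cbn; intuition lia end.

Ltac reg_val :=
  intros; upd_simpl;
  first [ eassumption
        | match goal with H : forall r, _ <= r -> _ r = 0 |- _ => apply H; lia end
        | reflexivity | lia ].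

Ltac side := solve [ eassumption | nodup | reg_val ].

Ltac call H := eapply ex_seq; [eapply H; side |].
Ltac last_call H := eapply exec_eq; [eapply H; side |].
Ltac regs_fin := regs_eq;
  try match goal with H : forall r, _ <= r -> _ r = 0 |- _ => rewrite H; lia end.

Definition compiled f (c : nat -> nat -> nat -> cmd) := forall x v i o t s,
  s i = x -> reval f x v -> i < t -> o < t -> i <> o -> s o = 0 ->
  (forall r, t <= r -> s r = 0) ->
  exec (c i o t) s (upd (upd s i 0) o v).

(** Register [1 + t] is a flag: a nonzero value of [f] raises it again and moves [t] to the next
    candidate. The induction is on the distance [d] from the candidate [m] to the answer. *)
Lemma exec_mu_loop f c i t x n :
  compiled f c ->
  reval f (cpair x n) 0 ->
  (forall m, m < n -> exists k, reval f (cpair x m) (S k)) ->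
  i < t ->
  forall d m s, m + d = n -> s i = x -> s t = m -> s (1 + t) = 1 ->
  (forall r, 2 + t <= r -> s r = 0) ->
  exec (CWhile (1 + t)
              (CSeq (copy i (2 + t) (3 + t))
              (CSeq (copy t (3 + t) (4 + t))
              (CSeq (pair_cmd (2 + t) (3 + t) (4 + t) (5 + t))
              (CSeq (c (4 + t) (5 + t) (6 + t))
                    (CWhile (5 + t)
                      (CSeq (clear (5 + t)) (CSeq (CInc (1 + t)) (CInc t)))))))))
    s (upd (upd s (1 + t) 0) t n).
Proof.
  intros Hf Hn Hlt Hi d.
  induction d as [|d IH]; intros m s Hmd Hsi Hst Hs1 Hs2.
  - assert (m = n) as -> by lia.
    eapply ex_whileS with (n := 0); [assumption | |].
    + call exec_copy_val. call exec_copy_val. call exec_pair_val. call Hf.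
      apply ex_while0. side.
    + eapply exec_eq; [apply ex_while0; side | regs_fin].
  - destruct (Hlt m ltac:(lia)) as [k Hk].
    eapply ex_whileS with (n := 0); [assumption | |].
    + call exec_copy_val. call exec_copy_val. call exec_pair_val. call Hf.
      eapply ex_whileS with (n := k); [side | |].
      * call exec_clear. call exec_inc_val. apply exec_inc_val. side.
      * apply ex_while0. side.
    + eapply exec_eq; [apply (IH (S m)); side | regs_fin].
Qed.

Theorem compile_correct f : compiled f (compile f).
Proof.
  induction f; intros x v i o t s Hsi Hev Hi Ho Hio Hso Hst;
    cbn [compile].
  - revert Hsi; inversion Hev; subst; intros Hsi. last_call exec_clear. regs_fin.
  - revert Hsi; inversion Hev; subst; intros Hsi. call exec_move_val. last_call exec_inc_val. regs_fin.
  - revert Hsi; inversion Hev; subst; intros Hsi. last_call exec_move_val. regs_fin.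
  - revert Hsi; inversion Hev; subst; intros Hsi.
    call exec_unpair. call exec_move_val. last_call exec_clear. regs_fin.
  - revert Hsi; inversion Hev; subst; intros Hsi.
    call exec_unpair. call exec_move_val. last_call exec_clear. regs_fin.
  - revert Hsi; inversion Hev; subst; intros Hsi.
    call exec_copy_val. call IHf1. call IHf2. last_call exec_pair_val. regs_fin.
  - revert Hsi; inversion Hev; subst; intros Hsi. call IHf2. last_call IHf1. regs_fin.
  - apply reval_prec in Hev as (x' & n & w & -> & Hw0 & <- & Hk).
    call exec_unpair. call exec_copy_val. call IHf1.
    econstructor.
    (* With [j] passes to go, [n - j] are done: this is both the recursion index and the position in
       the history [w]. *)
    { set (st := fun j => upd (upd (upd (upd (upd s i 0) t x') (1 + t) j)
                      (3 + t) (w (n - j))) (4 + t) (n - j)).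
      eapply exec_eq.
      - match goal with |- exec _ ?s0 _ => replace s0 with (st n) end.
        + apply exec_while_family; subst st; cbv beta.
          * intros j Hj. replace (n - j) with (S (n - S j)) by lia.
            specialize (Hk (n - S j) ltac:(lia)).
            call exec_copy_val. call exec_copy_val. call exec_pair_val. call exec_pair_val.
            call IHf2. last_call exec_inc_val. regs_fin.
          * intros. side.
        + subst st. cbv beta. rewrite Nat.sub_diag. regs_fin.
      - subst st. cbv beta. reflexivity. }
    rewrite Nat.sub_0_r.
    call exec_move_val. call exec_clear. last_call exec_clear. regs_fin.
  - revert Hsi; inversion Hev; subst; intros Hsi.
    call exec_inc_val.
    eapply ex_seq; [eapply (exec_mu_loop f (compile f) i t x v) with (d := v) (m := 0); side |].
    call exec_clear. last_call exec_move_val. regs_fin.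
Qed.

(** * Counter machines *)

Inductive eff : Type := EKeep | EInc (r : nat) | EDec (r : nat) | EZero (r : nat).

Definition gain (e : eff) (m : nat) : nat :=
  match e with EInc r => if m =? r then 1 else 0 | _ => 0 end.
Definition loss (e : eff) (m : nat) : nat :=
  match e with EDec r => if m =? r then 1 else 0 | _ => 0 end.

(** Stated without subtraction, so that decrementing an empty register has no successor: [EDec]
    contains its own test. *)
Definition effect (e : eff) (s s' : regs) : Prop :=
  match e with EZero r => s r = 0 | _ => True end /\
  forall m, s' m + loss e m = s m + gain e m.

Definition trans := (nat * eff * nat)%type.

Inductive steps (T : list trans) : nat -> regs -> nat -> regs -> Prop :=
| steps_refl q s : steps T q s q s
| steps_cons q e q1 s s1 q2 s2 :
    In (q, e, q1) T -> effect e s s1 -> steps T q1 s1 q2 s2 -> steps T q s q2 s2.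

Lemma steps_trans T q s q1 s1 q2 s2 :
  steps T q s q1 s1 -> steps T q1 s1 q2 s2 -> steps T q s q2 s2.
Proof. induction 1; eauto using steps. Qed.

Fixpoint size (c : cmd) : nat :=
  match c with
  | CSkip | CInc _ => 1
  | CSeq c d => size c + size d
  | CWhile _ c => 1 + size c
  end.

(** The exit [n] is a parameter because the body of a loop exits backwards, to the head of the
    loop. *)
Fixpoint code (c : cmd) (b n : nat) : list trans :=
  match c with
  | CSkip => [(b, EKeep, n)]
  | CInc r => [(b, EInc r, n)]
  | CSeq c d => code c b (b + size c) ++ code d (b + size c) n
  | CWhile r c => (b, EDec r, 1 + b) :: (b, EZero r, n) :: code c (1 + b) b
  end.

Lemma steps_code T c s s' :
  exec c s s' -> forall b n, incl (code c b n) T -> steps T b s n s'.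
Proof.
  induction 1; intros b m HT; cbn [code] in HT.
  - eapply steps_cons; [apply HT; now left | | constructor].
    split; [exact I | intros; cbn; lia].
  - eapply steps_cons; [apply HT; now left | | constructor].
    split; [exact I |]. intros x. unfold upd. cbn.
    destruct (Nat.eqb_spec x r); subst; lia.
  - apply incl_app_inv in HT as [H1 H2]. eauto using steps_trans.
  - eapply steps_cons; [apply HT; right; now left | | constructor].
    split; [assumption | intros; cbn; lia].
  - eapply steps_cons; [apply HT; now left | | eapply steps_trans with (q1 := b)].
    + split; [exact I |]. instantiate (1 := upd s r n).
      intros x. unfold upd. cbn. destruct (Nat.eqb_spec x r); subst; lia.
    + apply IHexec1. intros x Hx. apply HT. right. now right.
    + apply IHexec2. assumption.
Qed.

Lemma code_src c : forall b n q e q', In (q, e, q') (code c b n) -> b <= q < b + size c.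
Proof.
  induction c; cbn; intros b n q e q' H.
  - destruct H as [H|[]]; inversion H; lia.
  - destruct H as [H|[]]; inversion H; lia.
  - apply in_app_iff in H as [H|H]; [apply IHc1 in H | apply IHc2 in H]; lia.
  - destruct H as [H|[H|H]]; [inversion H; lia | inversion H; lia | apply IHc in H; lia].
Qed.

Lemma size_pos c : 0 < size c.
Proof. induction c; cbn; lia. Qed.

Definition deterministic (T : list trans) : Prop :=
  forall q e1 q1 e2 q2, In (q, e1, q1) T -> In (q, e2, q2) T ->
    e1 = e2 /\ q1 = q2 \/
    exists r, e1 = EDec r /\ e2 = EZero r \/ e1 = EZero r /\ e2 = EDec r.

Lemma deterministic_app T1 T2 :
  deterministic T1 -> deterministic T2 ->
  (forall q e1 q1 e2 q2, In (q, e1, q1) T1 -> ~ In (q, e2, q2) T2) ->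
  deterministic (T1 ++ T2).
Proof.
  intros H1 H2 Hd q e1 q1 e2 q2 Hin1 Hin2.
  apply in_app_iff in Hin1, Hin2.
  destruct Hin1 as [Ha|Ha], Hin2 as [Hb|Hb]; eauto.
  - now apply (Hd _ _ _ _ _ Ha) in Hb.
  - now apply (Hd _ _ _ _ _ Hb) in Ha.
Qed.

Lemma deterministic_single t : deterministic [t].
Proof.
  intros q e1 q1 e2 q2 [H1|[]] [H2|[]]. left. split; congruence.
Qed.

Lemma code_deterministic c : forall b n, deterministic (code c b n).
Proof.
  induction c; cbn [code]; intros b n; try apply deterministic_single.
  - apply deterministic_app; auto.
    intros q e1 q1 e2 q2 H1 H2. apply code_src in H1, H2. lia.
  - change (deterministic ([(b, EDec r, 1 + b); (b, EZero r, n)] ++ code c (1 + b) b)).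
    apply deterministic_app; auto.
    + intros q e1 q1 e2 q2 [H1|[H1|[]]] [H2|[H2|[]]]; inversion H1; inversion H2; subst; eauto.
    + intros q e1 q1 e2 q2 [H1|[H1|[]]] H2; inversion H1; apply code_src in H2; lia.
Qed.

(** A decrement needs a positive register where the matching zero test needs an empty one, so the
    two branches never apply together. *)
Lemma effect_det T q e1 q1 e2 q2 s s1 s2 :
  deterministic T -> In (q, e1, q1) T -> In (q, e2, q2) T ->
  effect e1 s s1 -> effect e2 s s2 -> q1 = q2 /\ s1 = s2.
Proof.
  intros HT H1 H2 [Ha Hb] [Hc Hd].
  destruct (HT _ _ _ _ _ H1 H2) as [[-> ->]|[r [[-> ->]|[-> ->]]]].
  - split; [reflexivity|]. apply functional_extensionality. intros m.
    specialize (Hb m). specialize (Hd m). lia.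
  - specialize (Hb r). cbn in *. rewrite Nat.eqb_refl in Hb. lia.
  - specialize (Hd r). cbn in *. rewrite Nat.eqb_refl in Hd. lia.
Qed.

Definition stuck (T : list trans) (q : nat) (s : regs) : Prop :=
  forall e q' s', In (q, e, q') T -> ~ effect e s s'.

Lemma steps_stuck_unique T q s q1 s1 q2 s2 :
  deterministic T -> steps T q s q1 s1 -> stuck T q1 s1 ->
  steps T q s q2 s2 -> stuck T q2 s2 -> q1 = q2.
Proof.
  intros HT H1. revert q2 s2.
  induction H1 as [q s|q e q1 s s1 q' s' Hin Heff H1 IH]; intros q2 s2 Hs1 H2 Hs2.
  - inversion H2; subst; [reflexivity|]. now edestruct Hs1; eauto.
  - inversion H2 as [|? e' q3 ? s3 ? ? Hin' Heff' H2']; subst; [now edestruct Hs2; eauto|].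
    destruct (effect_det _ _ _ _ _ _ _ _ _ HT Hin Hin' Heff Heff') as [-> ->]. eauto.
Qed.

(* Starts with the only transition out of state 0; accepts, in state
   [final_state], exactly if the output register 1 ends up nonzero. *)
Definition machine_cmd (f : rprog) : cmd := CSeq CSkip (compile f 0 1 2).
Definition test_state (f : rprog) : nat := size (machine_cmd f).
Definition final_state (f : rprog) : nat := 1 + test_state f.
Definition machine (f : rprog) : list trans :=
  code (machine_cmd f) 0 (test_state f) ++ [(test_state f, EDec 1, final_state f)].

Definition input_regs (n : nat) : regs := upd (fun _ => 0) 0 n.

Lemma machine_deterministic f : deterministic (machine f).
Proof.
  apply deterministic_app; [apply code_deterministic | apply deterministic_single |].
  intros q e1 q1 e2 q2 H1 [H2|[]]. inversion H2; subst. apply code_src in H1.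
  unfold test_state in H1. lia.
Qed.

Lemma machine_run f n v :
  reval f n v ->
  steps (machine f) 0 (input_regs n) (test_state f) (upd (upd (input_regs n) 0 0) 1 v).
Proof.
  intros H. eapply steps_code with (c := machine_cmd f).
  - eapply ex_seq; [constructor|].
    eapply compile_correct; eauto with arith.
    intros r Hr. unfold input_regs. upd_simpl. reflexivity.
  - apply incl_appl, incl_refl.
Qed.

Lemma machine_accepts f n :
  reval f n 1 -> exists s, steps (machine f) 0 (input_regs n) (final_state f) s.
Proof.
  intros H. exists (upd (upd (input_regs n) 0 0) 1 0).
  eapply steps_trans; [apply machine_run; eassumption|].
  eapply steps_cons; [apply in_app_iff; right; left; reflexivity | | constructor].
  split; [exact I|]. intros m. unfold gain, loss, input_regs. upd_simpl; lia.
Qed.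

(** With output 0 the run gets stuck in the test state. The final state has no way out either, and a
    deterministic machine can get stuck in one state only. *)
Lemma machine_rejects f n s :
  reval f n 0 -> ~ steps (machine f) 0 (input_regs n) (final_state f) s.
Proof.
  intros H Hacc. apply machine_run in H.
  assert (test_state f = final_state f); [|unfold final_state in *; lia].
  eapply steps_stuck_unique;
    [apply machine_deterministic | exact H | | exact Hacc |].
  - intros e q' s' Hin [_ Heff]. apply in_app_iff in Hin as [Hin|[Hin|[]]].
    + apply code_src in Hin. unfold test_state in Hin. lia.
    + inversion Hin; subst. specialize (Heff 1). cbn in Heff. unfold upd in Heff.
      cbn in Heff. lia.
  - intros e q' s' Hin _. apply in_app_iff in Hin as [Hin|[Hin|[]]].
    + apply code_src in Hin. unfold final_state, test_state in Hin. lia.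
    + apply (f_equal (fun t => fst (fst t))) in Hin. cbn [fst] in Hin.
      unfold final_state in Hin. lia.
Qed.

(** * Runs as words *)

(* A configuration is written as the transition [Tr t] about to be taken followed
   by any word of register letters, register [m] holding the number of letters
   [Rg m].  A run is the concatenation of its configurations, closed by [Fin]. *)
Inductive letter : Type := Fin | Tr (t : trans) | Rg (m : nat).

Definition src (t : trans) : nat := fst (fst t).
Definition act (t : trans) : eff := snd (fst t).
Definition dst (t : trans) : nat := snd t.

Fixpoint count_block (m : nat) (W : list letter) : nat :=
  match W with
  | Rg a :: W' => (if a =? m then 1 else 0) + count_block m W'
  | _ => 0
  end.

Fixpoint next_config (W : list letter) : option letter :=
  match W with
  | Rg _ :: W' => next_config W'
  | l :: _ => Some l
  | [] => None
  end.

Notation count u m := (count_occ Nat.eq_dec u m).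

Lemma count_cons a u m : count (a :: u) m = (if a =? m then 1 else 0) + count u m.
Proof. cbn. destruct (Nat.eq_dec a m), (Nat.eqb_spec a m); lia. Qed.

Lemma count_block_app m u W : count_block m (map Rg u ++ W) = count u m + count_block m W.
Proof.
  induction u as [|a u IH]; [reflexivity|]. rewrite count_cons. cbn [map app count_block]. lia.
Qed.

Lemma next_config_app u W : next_config (map Rg u ++ W) = next_config W.
Proof. induction u; auto. Qed.

Definition is_config (W : list letter) : Prop := forall a W', W <> Rg a :: W'.

Lemma block_unique u u' W W' :
  is_config W -> is_config W' -> map Rg u ++ W = map Rg u' ++ W' -> u = u' /\ W = W'.
Proof.
  intros HW HW'. revert u'.
  induction u as [|a u IH]; intros [|a' u'] H; cbn in H.
  - now split.
  - now apply HW in H.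
  - symmetry in H. now apply HW' in H.
  - injection H as -> H. now apply IH in H as [-> ->].
Qed.

Lemma split_at_config u W A t X :
  map Rg u ++ W = A ++ Tr t :: X -> exists A', W = A' ++ Tr t :: X.
Proof.
  revert A. induction u as [|a u IH]; intros A H; [now exists A|].
  destruct A as [|l A]; cbn in H; [discriminate|]. injection H as _ H. eauto.
Qed.

Section Words.

Context (T : list trans) (K : nat) (qf : nat).

(** [Fin] carries no registers, so the values after the last transition are left free; accordingly
    [error] compares two blocks only if a transition separates them. *)
Inductive valid : nat -> regs -> list letter -> Prop :=
| valid_fin s : valid qf s [Fin]
| valid_step t s u s' W :
    In t T -> (forall m, count u m = s m) -> effect (act t) s s' ->
    valid (dst t) s' W -> valid (src t) s (Tr t :: map Rg u ++ W).

(** Giving [Fin] the source [qf] turns the check of successive states, at the end of the word, into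
    the check for acceptance. *)
Definition source (l : letter) : nat := match l with Tr t => src t | _ => qf end.

(* The number of registers [m] after [t] should be that before plus [gain] minus
   [loss]; [excess] and [defect] are the least differences that violate this. *)
Definition excess (t : trans) (m : nat) : nat := 1 + gain (act t) m - loss (act t) m.
Definition defect (t : trans) (m : nat) : nat := 1 + loss (act t) m - gain (act t) m.

Inductive error (t : trans) (X : list letter) : Prop :=
| err_state l : next_config X = Some l -> source l <> dst t -> error t X
| err_zero r : act t = EZero r -> 0 < count_block r X -> error t X
| err_dec r : act t = EDec r -> count_block r X = 0 -> error t X
| err_more m u t' V :
    X = map Rg u ++ Tr t' :: V -> m < K -> count u m + excess t m <= count_block m V ->
    error t X
| err_less m u t' V :
    X = map Rg u ++ Tr t' :: V -> m < K -> count_block m V + defect t m <= count u m ->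
    error t X.

Lemma valid_is_config q s W : valid q s W -> is_config W.
Proof. intros HW a W'. destruct HW; discriminate. Qed.

Lemma is_config_Tr t W : is_config (Tr t :: W).
Proof. intros a W'. discriminate. Qed.

Lemma count_block_config m W : is_config W -> count_block m W = 0.
Proof. intros H. destruct W as [|[] W]; cbn; try reflexivity. now destruct (H m0 W). Qed.

Lemma valid_no_error q s W A t X :
  valid q s W -> W = A ++ Tr t :: X -> ~ error t X.
Proof.
  intros HW. revert A. induction HW as [s|t0 s u s' W Hin Hu Heff HW IH]; intros A HA.
  - destruct A as [|l A]; [discriminate|]. injection HA as _ HA. destruct A; discriminate.
  - pose proof (valid_is_config _ _ _ HW) as Hc.
    destruct A as [|l A]; injection HA as HA1 HA2.
    2: { apply split_at_config in HA2 as [A' ->]. eauto. }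
    subst t0 X. destruct Heff as [He Heff]. intros Herr.
    destruct Herr as [l Hn Hl | r Hr Hp | r Hr Hp | m u' t' V HX Hm Hc' | m u' t' V HX Hm Hc'].
    + rewrite next_config_app in Hn. inversion HW; subst; cbn in Hn; injection Hn as <-.
      * now apply Hl.
      * now apply Hl.
    + rewrite count_block_app, count_block_config, Hu in Hp by assumption.
      rewrite Hr in He. lia.
    + rewrite count_block_app, count_block_config, Hu in Hp by assumption.
      specialize (Heff r). rewrite Hr in Heff. cbn in Heff. rewrite Nat.eqb_refl in Heff. lia.
    + apply block_unique in HX as [<- ->]; [|assumption|apply is_config_Tr].
      inversion HW as [|? ? u' s'' W' _ Hu' _ HW']; subst.
      rewrite count_block_app, Hu, Hu', count_block_config in Hc'
        by (eapply valid_is_config; eassumption).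
      specialize (Heff m). unfold excess in Hc'. lia.
    + apply block_unique in HX as [<- ->]; [|assumption|apply is_config_Tr].
      inversion HW as [|? ? u' s'' W' _ Hu' _ HW']; subst.
      rewrite count_block_app, Hu, Hu', count_block_config in Hc'
        by (eapply valid_is_config; eassumption).
      specialize (Heff m). unfold defect in Hc'. lia.
Qed.

(** * Two-headed automata *)

(* [Scan]: the words with an error;
   [More m k]: more than [k] letters [Rg m] before the next configuration. *)
Inductive st1 : Type :=
| Start | Words | Scan | Any | Dst (q : nat) | Pos (m : nat) | More (m k : nat) | NoMore (m : nat).

(* The left head reads [u], ending with a transition, the right head reads [V]:
   [LeL m k] accepts if [count u m + k <= count_block m V], [GeL m k] if
   [count_block m V + k <= count u m]. *)
Inductive st2 : Type := LeL (m k : nat) | LeR (m k : nat) | GeL (m k : nat) | GeR (m : nat).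

Inductive target1 : Type := ToEnd | To (j : st1) | Fork (z : st2).
(** After [LeftDone] the right head goes on alone as a one-headed automaton and reads the word to
    its end. *)
Inductive target2 : Type := To2 (z : st2) | LeftDone (j : st1).

Definition reads_left (z : st2) : bool :=
  match z with LeL _ _ | GeL _ _ => true | LeR _ _ | GeR _ => false end.

Definition inner : list letter := map Tr T ++ map Rg (seq 0 K).
Definition letters : list letter := Fin :: inner.
Definition on_regs {A} (tgt : A) : list (letter * A) := map (fun a => (Rg a, tgt)) (seq 0 K).
Definition on_other_regs {A} (m : nat) (tgt : A) : list (letter * A) :=
  map (fun a => (Rg a, tgt)) (filter (fun a => negb (a =? m)) (seq 0 K)).
Definition on_trans {A} (tgt : A) : list (letter * A) := map (fun t => (Tr t, tgt)) T.

Definition out1 (i : st1) : list (letter * target1) :=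
  match i with
  | Start => on_trans (To Words)
  | Words => (Fin, ToEnd) :: map (fun l => (l, To Words)) inner
  | Scan =>
      map (fun l => (l, To Scan)) inner ++
      flat_map (fun t =>
        (Tr t, To (Dst (dst t))) ::
        match act t with
        | EZero r => [(Tr t, To (Pos r))]
        | EDec r => [(Tr t, To (NoMore r))]
        | _ => []
        end ++
        flat_map (fun m => [(Tr t, Fork (LeL m (excess t m))); (Tr t, Fork (GeL m (defect t m)))])
          (seq 0 K)) T
  | Any => map (fun l => (l, ToEnd)) letters ++ map (fun l => (l, To Any)) letters
  | Dst q =>
      on_regs (To (Dst q)) ++
      map (fun t => (Tr t, To Any)) (filter (fun t => negb (src t =? q)) T) ++
      (if qf =? q then [] else [(Fin, ToEnd)])
  | Pos m => (Rg m, To Any) :: on_regs (To (Pos m))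
  | More m 0 => (Rg m, To Any) :: on_regs (To (More m 0))
  | More m (S k) => (Rg m, To (More m k)) :: on_regs (To (More m (S k)))
  | NoMore m => (Fin, ToEnd) :: on_other_regs m (To (NoMore m)) ++ on_trans (To Any)
  end.

(** [LeL] matches each [Rg m] on the left with one on the right. [LeR] may pass over letters [Rg m],
    since a surplus on the right is allowed, and the [k] extra ones are demanded at the end. [GeL]
    first discards [k] letters [Rg m] on the left and may pass over more; [GeR] may skip none on the
    right, as each of those needs a partner. *)
Definition out2 (z : st2) : list (letter * target2) :=
  match z with
  | LeL m k =>
      (Rg m, To2 (LeR m k)) :: on_other_regs m (To2 (LeL m k)) ++
      on_trans (LeftDone (match k with 0 => Any | S k' => More m k' end))
  | LeR m k => (Rg m, To2 (LeL m k)) :: on_regs (To2 (LeR m k))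
  | GeL m 0 =>
      (Rg m, To2 (GeR m)) :: on_regs (To2 (GeL m 0)) ++ on_trans (LeftDone (NoMore m))
  | GeL m (S k) => (Rg m, To2 (GeL m k)) :: on_regs (To2 (GeL m (S k)))
  | GeR m => (Rg m, To2 (GeL m 0)) :: on_other_regs m (To2 (GeR m))
  end.

(** Only finitely many states may become predicates. [excess] and [defect] are at most 2, so the
    offsets below 3 suffice in [states2], and [More] is needed for 0 and 1. *)
Definition states1 : list st1 :=
  [Start; Words; Scan; Any] ++ map Dst (map dst T) ++
  flat_map (fun m => [Pos m; More m 0; More m 1; NoMore m]) (seq 0 K).

Definition states2 : list st2 :=
  flat_map (fun m => GeR m :: flat_map (fun k => [LeL m k; LeR m k; GeL m k]) (seq 0 3))
    (seq 0 K).

Inductive acc1 : st1 -> list letter -> Prop :=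
| acc_end i l : In i states1 -> In (l, ToEnd) (out1 i) -> acc1 i [l]
| acc_to i l j W : In i states1 -> In (l, To j) (out1 i) -> acc1 j W -> acc1 i (l :: W)
| acc_fork i l z U V :
    In i states1 -> In (l, Fork z) (out1 i) -> acc2 z U V -> acc1 i (l :: U ++ V)
with acc2 : st2 -> list letter -> list letter -> Prop :=
| acc_left z l z' U V :
    In z states2 -> reads_left z = true -> In (l, To2 z') (out2 z) ->
    acc2 z' U V -> acc2 z (l :: U) V
| acc_right z l z' U V :
    In z states2 -> reads_left z = false -> In (l, To2 z') (out2 z) ->
    acc2 z' U V -> acc2 z U (l :: V)
| acc_left_done z l j V :
    In z states2 -> reads_left z = true -> In (l, LeftDone j) (out2 z) ->
    acc1 j V -> acc2 z [l] V.

Scheme acc1_mut := Minimality for acc1 Sort Prop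
  with acc2_mut := Minimality for acc2 Sort Prop.
Combined Scheme acc_mut from acc1_mut, acc2_mut.

Inductive closed_word : list letter -> Prop :=
| closed_nil : closed_word [Fin]
| closed_cons l W : In l inner -> closed_word W -> closed_word (l :: W).

Definition meaning1 (i : st1) (W : list letter) : Prop :=
  match i with
  | Start => exists t X, W = Tr t :: X /\ In t T /\ closed_word X
  | Words => closed_word W
  | Scan => exists A t X, W = A ++ Tr t :: X /\ error t X
  | Any => True
  | Dst q => exists l, next_config W = Some l /\ source l <> q
  | Pos m => 0 < count_block m W
  | More m k => k < count_block m W
  | NoMore m => count_block m W = 0
  end.

(** In [LeR] and [GeR] the left head has read one [Rg m] whose partner is still to come on the
    right, whence the successors. *)
Definition meaning2 (z : st2) (U V : list letter) : Prop :=
  exists u t, U = map Rg u ++ [Tr t] /\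
  match z with
  | LeL m k => count u m + k <= count_block m V
  | LeR m k => S (count u m + k) <= count_block m V
  | GeL m k => count_block m V + k <= count u m
  | GeR m => count_block m V <= S (count u m)
  end.

Ltac in_out :=
  repeat match goal with
  | H : _ \/ _ |- _ => destruct H as [H|H]
  | H : False |- _ => destruct H
  | H : In _ (_ ++ _) |- _ => apply in_app_iff in H
  | H : In _ (_ :: _) |- _ => destruct H as [H|H]
  | H : In _ [] |- _ => destruct H
  | H : In _ (on_regs _) |- _ => unfold on_regs in H
  | H : In _ (on_other_regs _ _) |- _ => unfold on_other_regs in H
  | H : In _ (on_trans _) |- _ => unfold on_trans in H
  | H : In _ (map _ _) |- _ => apply in_map_iff in H as (? & H & ?)
  | H : In _ (flat_map _ _) |- _ => apply in_flat_map in H as (? & ? & H)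
  | H : In _ (filter _ _) |- _ => apply filter_In in H as [H ?]
  | H : (_, _) = (_, _) |- _ => inversion H; clear H; subst
  | H : negb _ = true |- _ => apply Bool.negb_true_iff in H; apply Nat.eqb_neq in H
  | H : In _ (if ?b then _ else _) |- _ => destruct b eqn:?
  | H : (_ =? _) = false |- _ => apply Nat.eqb_neq in H
  | H : In _ (seq _ _) |- _ => apply in_seq in H
  end.

(** * Soundness of the automata *)

Lemma acc_sound :
  (forall i W, acc1 i W -> meaning1 i W) /\ (forall z U V, acc2 z U V -> meaning2 z U V).
Proof.
  apply acc_mut.
  - intros i l _ Hl. destruct i; cbn [out1] in Hl; try destruct k; in_out; cbn; auto.
    + constructor.
    + destruct (act x); in_out.
    + exists Fin. auto.
  - intros i l j W _ Hl _ IH.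
    destruct i; cbn [out1] in Hl; try destruct k; in_out;
      cbn [meaning1 count_block next_config] in *; rewrite ?Nat.eqb_refl; try lia; auto.
    + now exists x, W.
    + now constructor.
    + destruct IH as (A & t & X & -> & Herr). now exists (l :: A), t, X.
    + destruct IH as (l & Hl & Hne). exists [], x, W. split; [reflexivity|].
      now apply err_state with l.
    + destruct (act x) eqn:Ha; in_out; exists [], x, W; (split; [reflexivity|]).
      * now apply err_dec with r.
      * now apply err_zero with r.
    + exists (Tr x). auto.
    + apply Nat.eqb_neq in H0. rewrite H0. assumption.
  - intros i l z U V _ Hl _ IH.
    destruct i; cbn [out1] in Hl; try destruct k; in_out.
    + destruct (act x); in_out.
    + destruct IH as (u & t & -> & IH). exists [], x, ((map Rg u ++ [Tr t]) ++ V).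
      split; [reflexivity|]. rewrite <- app_assoc.
      now apply err_more with x0 u t V.
    + destruct IH as (u & t & -> & IH). exists [], x, ((map Rg u ++ [Tr t]) ++ V).
      split; [reflexivity|]. rewrite <- app_assoc.
      now apply err_less with x0 u t V.
  - intros z l z' U V _ Hz Hl _ (u & t & -> & IH).
    destruct z; try discriminate; cbn [out2] in Hl; try destruct k; in_out.
    all: match goal with |- meaning2 _ (Rg ?a :: _) _ => exists (a :: u), t; split; [reflexivity|] end.
    all: rewrite count_cons, ?Nat.eqb_refl.
    all: try (match goal with H : _ <> _ |- _ => apply Nat.eqb_neq in H; rewrite H end).
    all: lia.
  - intros z l z' U V _ Hz Hl _ (u & t & -> & IH).
    destruct z; try discriminate; cbn [out2] in Hl; try destruct k; in_out.
    all: exists u, t; split; [reflexivity|]; cbn [count_block]; rewrite ?Nat.eqb_refl.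
    all: try (match goal with H : _ <> _ |- _ => apply Nat.eqb_neq in H; rewrite H end).
    all: lia.
  - intros z l j V _ Hz Hl _ IH.
    destruct z; try discriminate; cbn [out2] in Hl; try destruct k; in_out.
    all: match goal with |- meaning2 _ [Tr ?t] _ => exists [], t; split; [reflexivity|] end.
    all: cbn in *; lia.
Qed.

Lemma in_inner_Tr t : In (Tr t) inner <-> In t T.
Proof.
  unfold inner. rewrite in_app_iff, !in_map_iff. split; [|eauto].
  intros [(? & H & ?)|(? & H & ?)]; inversion H; now subst.
Qed.

Lemma in_inner_Rg a : In (Rg a) inner <-> a < K.
Proof.
  unfold inner. rewrite in_app_iff, !in_map_iff. split.
  - intros [(? & H & ?)|(? & H & Hin)]; inversion H; subst. apply in_seq in Hin. lia.
  - intros H. right. exists a. split; [reflexivity|]. apply in_seq. lia.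
Qed.

Lemma in_letters_Tr t : In (Tr t) letters <-> In t T.
Proof.
  rewrite <- (in_inner_Tr t). split; [intros [H|H]; [discriminate|exact H] | now right].
Qed.

Lemma in_letters_Rg m : In (Rg m) letters <-> m < K.
Proof.
  rewrite <- (in_inner_Rg m). split; [intros [H|H]; [discriminate|exact H] | now right].
Qed.

(** Only letters of the alphabet have a parameter that stands for them; the rules of an automaton
    are meaningful because no other letter is read. *)
Lemma out1_letter i l tgt :
  In i states1 -> In (l, tgt) (out1 i) -> In l letters.
Proof.
  intros Hi He.
  assert (Hm : forall m, In m (seq 0 K) -> In (Rg m) letters)
    by (intros m Hm; apply in_seq in Hm; apply in_letters_Rg; lia).
  assert (Hi' : match i with Pos m | More m _ => In m (seq 0 K) | _ => True end).
  { unfold states1 in Hi. rewrite !in_app_iff, in_flat_map in Hi.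
    destruct Hi as [Hi|[Hi|(m & Hk & Hi)]].
    - repeat (destruct Hi as [<-|Hi]; [exact I|]). now destruct Hi.
    - apply in_map_iff in Hi as (? & <- & _). exact I.
    - repeat (destruct Hi as [<-|Hi]; [exact I || assumption|]). now destruct Hi. }
  clear Hi. destruct i; cbn [out1] in He; try destruct k; in_out;
    rewrite ?in_letters_Tr; auto; try (now left); try (now right);
    try (apply in_letters_Rg; lia).
  destruct (act x); in_out; now apply in_letters_Tr.
Qed.

Lemma out2_letter z l tgt :
  In z states2 -> In (l, tgt) (out2 z) -> In l letters.
Proof.
  intros Hz He.
  assert (Hm : match z with LeL m _ | LeR m _ | GeL m _ | GeR m => m < K end).
  { unfold states2 in Hz. apply in_flat_map in Hz as (m & Hk & Hz). apply in_seq in Hk.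
    cbn in Hz. repeat (destruct Hz as [<-|Hz]; [lia|]). destruct Hz. }
  destruct z; cbn [out2] in He; try destruct k; in_out;
    rewrite ?in_letters_Tr, ?in_letters_Rg; auto; lia.
Qed.

Lemma in_on_regs A (tgt : A) a : a < K -> In (Rg a, tgt) (on_regs tgt).
Proof. intros. apply in_map_iff. exists a. split; [reflexivity|]. apply in_seq. lia. Qed.

Lemma in_on_other_regs A m (tgt : A) a : a < K -> a <> m -> In (Rg a, tgt) (on_other_regs m tgt).
Proof.
  intros Ha Hm. apply in_map_iff. exists a. split; [reflexivity|]. apply filter_In. split.
  - apply in_seq. lia.
  - now apply Bool.negb_true_iff, Nat.eqb_neq.
Qed.

Lemma in_on_trans A (tgt : A) t : In t T -> In (Tr t, tgt) (on_trans tgt).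
Proof. intros. apply in_map_iff. eauto. Qed.

Lemma in_states1 i :
  match i with
  | Start | Words | Scan | Any => True
  | Dst q => exists t, In t T /\ dst t = q
  | More m k => m < K /\ k < 2
  | Pos m | NoMore m => m < K
  end -> In i states1.
Proof.
  unfold states1. intros H. rewrite !in_app_iff, in_flat_map.
  destruct i; cbn; auto 6.
  - right. left. apply in_map. destruct H as (t & Ht & <-). now apply in_map.
  - do 2 right. exists m. rewrite in_seq. split; [lia|auto].
  - do 2 right. exists m. rewrite in_seq. split; [lia|].
    destruct k as [|[|]]; [auto | auto | lia].
  - do 2 right. exists m. rewrite in_seq. split; [lia|auto 6].
Qed.

Lemma in_states2 z :
  match z with
  | LeL m k | LeR m k | GeL m k => m < K /\ k < 3
  | GeR m => m < K
  end -> In z states2.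
Proof.
  unfold states2. intros H. rewrite in_flat_map.
  destruct z; exists m; rewrite in_seq; (split; [lia|]); cbn.
  4: now left.
  all: destruct k as [|[|[|]]]; auto 12; lia.
Qed.

(** * Completeness of the automata *)

Lemma any_complete W : closed_word W -> acc1 Any W.
Proof.
  assert (HS : In Any states1) by now apply in_states1.
  induction 1 as [|l W Hl HW IH].
  - apply acc_end; [assumption|]. apply in_app_iff. left. apply in_map_iff.
    exists Fin. split; [reflexivity | now left].
  - eapply acc_to; [assumption | | exact IH]. apply in_app_iff. right. apply in_map_iff.
    exists l. split; [reflexivity | now right].
Qed.

Lemma words_complete W : closed_word W -> acc1 Words W.
Proof.
  assert (HS : In Words states1) by now apply in_states1.
  induction 1 as [|l W Hl HW IH].
  - apply acc_end; [assumption | now left].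
  - eapply acc_to; [assumption | | exact IH]. right. apply in_map_iff. eauto.
Qed.

Lemma start_complete t W : In t T -> closed_word W -> acc1 Start (Tr t :: W).
Proof.
  intros Ht HW. apply acc_to with Words.
  - now apply in_states1.
  - now apply in_on_trans.
  - now apply words_complete.
Qed.

Lemma closed_word_inv l W :
  closed_word (l :: W) ->
  match l with
  | Fin => W = []
  | Tr t => In t T /\ closed_word W
  | Rg a => a < K /\ closed_word W
  end.
Proof.
  inversion 1; subst; [reflexivity|]. destruct l.
  - unfold inner in *. rewrite in_app_iff, !in_map_iff in *.
    destruct H2 as [(? & ? & ?)|(? & ? & ?)]; discriminate.
  - now rewrite in_inner_Tr in *.
  - now rewrite in_inner_Rg in *.
Qed.

Lemma dst_complete q W l :
  (exists t, In t T /\ dst t = q) -> closed_word W ->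
  next_config W = Some l -> source l <> q -> acc1 (Dst q) W.
Proof.
  intros Hq HW Hn Hl.
  assert (HS : In (Dst q) states1) by now apply in_states1.
  induction W as [|x W IH]; [discriminate|].
  apply closed_word_inv in HW. destruct x as [|t|a].
  - subst. injection Hn as <-. apply acc_end; [assumption|]. cbn [out1].
    rewrite !in_app_iff. right. right. cbn in Hl.
    destruct (Nat.eqb_spec qf q); [contradiction | now left].
  - injection Hn as <-. destruct HW as [Ht HW].
    eapply acc_to; [assumption | | apply any_complete; assumption]. cbn [out1].
    rewrite !in_app_iff. right. left. apply in_map_iff. exists t. split; [reflexivity|].
    apply filter_In. split; [assumption|]. now apply Bool.negb_true_iff, Nat.eqb_neq.
  - destruct HW as [Ha HW]. eapply acc_to; [assumption | | apply IH; assumption].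
    apply in_app_iff. left. now apply in_on_regs.
Qed.

Lemma pos_complete m W : m < K -> closed_word W -> 0 < count_block m W -> acc1 (Pos m) W.
Proof.
  intros Hm HW Hc.
  assert (HS : In (Pos m) states1) by now apply in_states1.
  induction W as [|x W IH]; [inversion Hc|].
  apply closed_word_inv in HW. destruct x as [|t|a]; [inversion Hc | inversion Hc |].
  destruct HW as [Ha HW]. cbn in Hc. destruct (Nat.eqb_spec a m).
  - subst. eapply acc_to; [assumption | left; reflexivity | now apply any_complete].
  - eapply acc_to; [assumption | right; now apply in_on_regs | auto].
Qed.

(** The state for at least [k] letters, whereas [More m k] asks for more than [k]. It is the target
    of [LeftDone] in [out2]. *)
Definition more (m k : nat) : st1 := match k with 0 => Any | S k => More m k end.

Lemma more_complete m W : m < K -> closed_word W ->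
  forall k, k < 3 -> k <= count_block m W -> acc1 (more m k) W.
Proof.
  intros Hm. induction W as [|x W IH]; intros HW k Hk Hc; [inversion HW|].
  destruct k as [|k]; [now apply any_complete|]. cbn [more].
  assert (HS : In (More m k) states1) by (apply in_states1; lia).
  apply closed_word_inv in HW. destruct x as [|t|a]; [inversion Hc | inversion Hc |].
  destruct HW as [Ha HW]. cbn in Hc. destruct (Nat.eqb_spec a m).
  - subst. eapply acc_to with (j := more m k); [assumption | | apply IH; [assumption|lia|lia]].
    destruct k; now left.
  - eapply acc_to with (j := More m k); [assumption | | apply (IH HW (S k)); lia].
    destruct k; right; now apply in_on_regs.
Qed.

Lemma no_more_complete m W : m < K -> closed_word W -> count_block m W = 0 -> acc1 (NoMore m) W.
Proof.
  intros Hm HW Hc.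
  assert (HS : In (NoMore m) states1) by now apply in_states1.
  induction W as [|x W IH]; [inversion HW|].
  apply closed_word_inv in HW. destruct x as [|t|a].
  - subst. apply acc_end; [assumption | now left].
  - destruct HW as [Ht HW]. eapply acc_to; [assumption | | now apply any_complete].
    right. apply in_app_iff. right. now apply in_on_trans.
  - destruct HW as [Ha HW]. cbn in Hc. destruct (Nat.eqb_spec a m); [discriminate|].
    eapply acc_to; [assumption | | auto].
    right. apply in_app_iff. left. now apply in_on_other_regs.
Qed.

Lemma closed_word_regs u W : closed_word (map Rg u ++ W) -> Forall (fun a => a < K) u /\ closed_word W.
Proof.
  induction u as [|a u IH]; cbn; intros H; [now split|].
  apply closed_word_inv in H as [Ha H]. apply IH in H as [H1 H2]. auto.
Qed.

Lemma le_complete m k t u : forall V,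
  m < K -> k < 3 -> In t T -> Forall (fun a => a < K) u -> closed_word V ->
  count u m + k <= count_block m V -> acc2 (LeL m k) (map Rg u ++ [Tr t]) V.
Proof.
  induction u as [|a u IH]; intros V Hm Hk Ht Hu HV Hc;
    assert (HL : In (LeL m k) states2) by (apply in_states2; lia).
  - apply acc_left_done with (more m k); [assumption | reflexivity | | now apply more_complete].
    right. apply in_app_iff. right. now apply in_on_trans.
  - inversion Hu; subst. rewrite count_cons in Hc. cbn [map app].
    destruct (Nat.eqb_spec a m) as [->|Hne].
    + eapply acc_left; [assumption | reflexivity | now left |].
      assert (HR : In (LeR m k) states2) by (apply in_states2; lia).
      (* The right head advances to its next [Rg m]; the count guarantees one before the next
         configuration. *)
      induction V as [|x V IHV]; [cbn in Hc; lia|].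
      apply closed_word_inv in HV. destruct x as [|t'|b]; [cbn in Hc; lia | cbn in Hc; lia |].
      destruct HV as [Hb HV]. cbn [count_block] in Hc. destruct (Nat.eqb_spec b m) as [->|Hne].
      * eapply acc_right; [assumption | reflexivity | now left |]. apply IH; auto; lia.
      * eapply acc_right; [assumption | reflexivity | right; now apply in_on_regs |]. auto.
    + eapply acc_left; [assumption | reflexivity | | apply IH; auto].
      right. apply in_app_iff. left. now apply in_on_other_regs.
Qed.

(** While [k] is positive, an [Rg m] on the left is discarded. Once [k] is 0 it is passed over if
    the rest of the left block still suffices; otherwise both counts are equal and it must be
    matched, so the right block contains an [Rg m]. *)
Lemma ge_complete m t u : forall k V,
  m < K -> k < 3 -> In t T -> Forall (fun a => a < K) u -> closed_word V ->
  count_block m V + k <= count u m -> acc2 (GeL m k) (map Rg u ++ [Tr t]) V.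
Proof.
  induction u as [|a u IH]; intros k V Hm Hk Ht Hu HV Hc;
    assert (HL : In (GeL m k) states2) by (apply in_states2; lia).
  - cbn in Hc. assert (k = 0) as -> by lia.
    apply acc_left_done with (NoMore m);
      [assumption | reflexivity | | apply no_more_complete; auto; lia].
    right. apply in_app_iff. right. now apply in_on_trans.
  - inversion Hu; subst. rewrite count_cons in Hc. cbn [map app].
    assert (Hskip : count_block m V + k <= count u m ->
                    acc2 (GeL m k) (Rg a :: map Rg u ++ [Tr t]) V).
    { intros Hc'. eapply acc_left with (z' := GeL m k); [assumption | reflexivity | | apply IH; auto].
      destruct k; right; [apply in_app_iff; left|]; now apply in_on_regs. }
    destruct (Nat.eqb_spec a m) as [->|Hne]; [|auto].
    destruct k as [|k].
    + destruct (le_lt_dec (count_block m V + 0) (count u m)) as [Hle|Hlt]; [auto|].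
      eapply acc_left; [assumption | reflexivity | now left |].
      assert (HR : In (GeR m) states2) by (apply in_states2; lia).
      clear Hskip.
      induction V as [|x V IHV]; [cbn in Hlt; lia|].
      apply closed_word_inv in HV. destruct x as [|t'|b]; [cbn in Hlt; lia | cbn in Hlt; lia |].
      destruct HV as [Hb HV]. cbn [count_block] in Hc, Hlt.
      destruct (Nat.eqb_spec b m) as [->|Hne].
      * eapply acc_right; [assumption | reflexivity | now left |]. apply IH; auto; lia.
      * eapply acc_right; [assumption | reflexivity | right; now apply in_on_other_regs |]. auto.
    + eapply acc_left; [assumption | reflexivity | now left | apply IH; auto; lia].
Qed.

Definition uses (e : eff) (r : nat) : Prop :=
  match e with EKeep => False | EInc x | EDec x | EZero x => x = r end.

Context (HK : forall t r, In t T -> uses (act t) r -> r < K).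

Lemma in_out_scan t x :
  In t T ->
  x = (Tr t, To (Dst (dst t))) \/
  (exists r, act t = EZero r /\ x = (Tr t, To (Pos r))) \/
  (exists r, act t = EDec r /\ x = (Tr t, To (NoMore r))) \/
  (exists m, m < K /\
     (x = (Tr t, Fork (LeL m (excess t m))) \/ x = (Tr t, Fork (GeL m (defect t m))))) ->
  In x (out1 Scan).
Proof.
  intros Ht Hx. cbn [out1]. apply in_app_iff. right. apply in_flat_map. exists t.
  split; [assumption|].
  destruct Hx as [->|[(r & Hr & ->)|[(r & Hr & ->)|(m & Hm & Hx)]]].
  - now left.
  - right. rewrite Hr. now left.
  - right. rewrite Hr. now left.
  - right. apply in_app_iff. right. apply in_flat_map. exists m.
    rewrite in_seq. split; [lia|]. destruct Hx as [->| ->]; cbn; auto.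
Qed.

Lemma error_scan t X : In t T -> closed_word X -> error t X -> acc1 Scan (Tr t :: X).
Proof.
  intros Ht HX Herr.
  assert (HS : In Scan states1) by now apply in_states1.
  assert (He : forall m, excess t m < 3 /\ defect t m < 3).
  { intros m. unfold excess, defect. destruct (act t); cbn; try destruct (m =? r); lia. }
  pose proof (in_out_scan t) as Hout.
  destruct Herr as [l Hn Hl | r Hr Hp | r Hr Hp | m u t' V HV Hm Hc | m u t' V HV Hm Hc].
  - eapply acc_to; [assumption | apply Hout; auto | eapply dst_complete; eauto].
  - eapply acc_to; [assumption | apply Hout; eauto | apply pos_complete; auto].
    apply HK with t; [assumption | now rewrite Hr].
  - eapply acc_to; [assumption | apply Hout; eauto 6 | apply no_more_complete; auto].
    apply HK with t; [assumption | now rewrite Hr].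
  - subst X. apply closed_word_regs in HX as [Hu HX]. apply closed_word_inv in HX as [Ht' HX].
    replace (map Rg u ++ Tr t' :: V) with ((map Rg u ++ [Tr t']) ++ V) by now rewrite <- app_assoc.
    apply acc_fork with (LeL m (excess t m));
      [assumption | apply Hout; eauto 8 | apply le_complete; auto; apply He].
  - subst X. apply closed_word_regs in HX as [Hu HX]. apply closed_word_inv in HX as [Ht' HX].
    replace (map Rg u ++ Tr t' :: V) with ((map Rg u ++ [Tr t']) ++ V) by now rewrite <- app_assoc.
    apply acc_fork with (GeL m (defect t m));
      [assumption | apply Hout; eauto 8 | apply ge_complete; auto; apply He].
Qed.

Lemma scan_prefix A W : Forall (fun l => In l inner) A -> acc1 Scan W -> acc1 Scan (A ++ W).
Proof.
  induction 1; cbn; auto. intros HW. eapply acc_to with (j := Scan); auto.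
  - now apply in_states1.
  - apply in_app_iff. left. apply in_map_iff. eauto.
Qed.

Lemma closed_word_parse X :
  closed_word X -> exists u W, X = map Rg u ++ W /\ Forall (fun a => a < K) u /\
    (W = [Fin] \/ exists t X', W = Tr t :: X' /\ In t T /\ closed_word X').
Proof.
  induction X as [|l X IH]; intros HX; [inversion HX|].
  apply closed_word_inv in HX. destruct l as [|t|a].
  - subst. exists [], [Fin]. auto.
  - exists [], (Tr t :: X). intuition. right. eauto.
  - destruct HX as [Ha HX]. destruct (IH HX) as (u & W & -> & Hu & HW).
    exists (a :: u), W. auto.
Qed.

Lemma count_above u m : Forall (fun a => a < K) u -> K <= m -> count u m = 0.
Proof.
  intros Hu Hm. apply count_occ_not_In. intros Hin. rewrite Forall_forall in Hu.
  apply Hu in Hin. lia.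
Qed.

(** The list of errors is complete: a word without any of them is a run from the registers that its
    first block describes. The bound [n] on the length is there because the recursion jumps to the
    next configuration. *)
Lemma scan_or_valid n : forall t X,
  length X < n -> In t T -> closed_word X ->
  acc1 Scan (Tr t :: X) \/ valid (src t) (fun m => count_block m X) (Tr t :: X).
Proof.
  induction n as [|n IH]; intros t X Hlen Ht HX; [lia|].
  destruct (classic (error t X)) as [He|He]; [left; now apply error_scan|].
  destruct (closed_word_parse X HX) as (u & W & -> & Hu & HW).
  assert (Hsrc : forall l, next_config W = Some l -> source l = dst t).
  { intros l Hl. destruct (Nat.eq_dec (source l) (dst t)) as [|Hne]; [assumption|].
    destruct He. apply err_state with l; [now rewrite next_config_app | assumption]. }
  assert (Hcfg : is_config W) by (destruct HW as [->|(? & ? & -> & _)]; intros ? ?; discriminate).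
  assert (Hu' : forall m, count u m = count_block m (map Rg u ++ W)).
  { intros m. rewrite count_block_app, count_block_config by assumption. lia. }
  assert (Hzero : match act t with EZero r => count u r = 0 | EDec r => 0 < count u r | _ => True end).
  { destruct (act t) eqn:Ha; try exact I; rewrite Hu'.
    - destruct (count_block r _) eqn:Hr; [|lia]. destruct He. now apply err_dec with r.
    - destruct (count_block r _) eqn:Hr; [reflexivity|]. destruct He. apply err_zero with r; [assumption|lia]. }
  destruct HW as [->|(t' & X' & -> & Ht' & HX')].
  (* The word does not record the registers after its last transition, so they are computed from
     it. *)
  - right. apply valid_step with
      (s' := fun m => count u m + gain (act t) m - loss (act t) m); auto.
    + split; [destruct (act t); auto; now rewrite <- Hu'|].
      intros m. rewrite <- Hu'. destruct (act t) as [|r|r|r]; cbn; try lia.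
      destruct (Nat.eqb_spec m r); subst; lia.
    + rewrite <- (Hsrc Fin eq_refl). constructor.
  - destruct (IH t' X') as [Hs|Hv]; auto.
    + rewrite length_app in Hlen. cbn in Hlen. lia.
    + left. change (Tr t :: map Rg u ++ Tr t' :: X') with ((Tr t :: map Rg u) ++ Tr t' :: X').
      apply scan_prefix; [|assumption]. constructor; [now apply in_inner_Tr|].
      rewrite Forall_forall in *. intros l Hl. apply in_map_iff in Hl as (a & <- & Ha).
      now apply in_inner_Rg, Hu.
    + right. apply valid_step with (s' := fun m => count_block m X'); auto.
      * split; [destruct (act t); auto; now rewrite <- Hu'|].
        intros m. rewrite <- Hu'.
        (* Errors concern registers below [K]. From [K] on there are no letters in either block, and
           no transition touches the register. *)
        destruct (le_lt_dec K m) as [Hm|Hm].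
        -- destruct (closed_word_parse X' HX') as (u2 & W2 & -> & Hu2 & HW2).
           assert (is_config W2) by (destruct HW2 as [->|(? & ? & -> & _)]; intros ? ?; discriminate).
           rewrite count_block_app, count_block_config, !count_above by assumption.
           pose proof (HK t) as HKt. destruct (act t) as [|r|r|r]; cbn; try lia;
             (destruct (Nat.eqb_spec m r); [|lia]; specialize (HKt r Ht eq_refl); lia).
        -- assert (~ count u m + excess t m <= count_block m X')
             by (intros ?; apply He; eapply err_more; eauto).
           assert (~ count_block m X' + defect t m <= count u m)
             by (intros ?; apply He; eapply err_less; eauto).
           unfold excess, defect in *. destruct (act t) as [|r|r|r]; cbn in *; try lia;
             destruct (m =? r); lia.
      * rewrite <- (Hsrc (Tr t') eq_refl). exact Hv.
Qed.

(** * Valid words and runs of the machine *)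

Lemma valid_steps q s W : valid q s W -> exists s', steps T q s qf s'.
Proof.
  induction 1 as [s|t s u s' W Ht Hu He HW [s2 IH]]; [eexists; constructor|].
  exists s2. eapply steps_cons; [|exact He|exact IH]. now destruct t as [[? ?] ?].
Qed.

Definition block (s : regs) : list nat := flat_map (fun m => repeat m (s m)) (seq 0 K).

Lemma count_block_regs s m : (forall r, K <= r -> s r = 0) -> count (block s) m = s m.
Proof.
  intros Hs. unfold block.
  assert (H : forall n a, count (flat_map (fun r => repeat r (s r)) (seq a n)) m
                 = if andb (a <=? m) (m <? a + n) then s m else 0).
  { induction n as [|n IH]; intros a; cbn [seq flat_map].
    - destruct (Nat.leb_spec a m), (Nat.ltb_spec m (a + 0)); cbn; lia.
    - rewrite count_occ_app, IH, Nat.add_succ_comm.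
      destruct (Nat.eq_dec a m) as [->|Hne].
      + rewrite count_occ_repeat_eq by reflexivity.
        destruct (Nat.leb_spec m m), (Nat.leb_spec (S m) m), (Nat.ltb_spec m (m + S n)); cbn; lia.
      + rewrite count_occ_repeat_neq by auto.
        destruct (Nat.leb_spec a m), (Nat.leb_spec (S a) m), (Nat.ltb_spec m (a + S n)); cbn; lia. }
  rewrite H. destruct (Nat.leb_spec 0 m), (Nat.ltb_spec m (0 + K)); cbn; try lia.
  symmetry. apply Hs. lia.
Qed.

(** The first configuration is exposed with its letters in the order of [block], because for the
    input it has to be the very block that [chain] writes down. What follows it is exposed as well,
    to show that another transition comes next. *)
Lemma steps_valid q s qf' s' :
  steps T q s qf' s' -> qf' = qf -> (forall r, K <= r -> s r = 0) ->
  valid q s [Fin] \/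
  exists t s1 W, In t T /\ src t = q /\ closed_word W /\ valid (dst t) s1 W /\
    valid q s (Tr t :: map Rg (block s) ++ W).
Proof.
  induction 1 as [q s|q e q1 s s1 q2 s2 Hin He Hst IH]; intros Hq Hs.
  - subst. left. constructor.
  - right. exists (q, e, q1), s1.
    assert (Hs1 : forall r, K <= r -> s1 r = 0).
    { intros r Hr. destruct He as [_ He]. specialize (He r). rewrite (Hs r Hr) in He.
      pose proof (HK _ r Hin) as HKr. unfold act in HKr. cbn in HKr.
      destruct e as [|x|x|x]; cbn in *; try lia; destruct (Nat.eqb_spec r x); try lia. }
    assert (Hstep : forall W, valid q1 s1 W -> valid q s (Tr (q, e, q1) :: map Rg (block s) ++ W)).
    { intros W HW. change q with (src (q, e, q1)) at 1. apply valid_step with s1; auto.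
      intros m. now apply count_block_regs. }
    destruct (IH Hq Hs1) as [HW|(t & s3 & W & Ht & Hsrc & HW & _ & Hv)].
    + exists [Fin]. repeat split; auto. constructor.
    + exists (Tr t :: map Rg (block s1) ++ W). repeat split; auto.
      constructor; [now apply in_inner_Tr|].
      assert (Hb : Forall (fun a => a < K) (block s1)).
      { apply Forall_forall. intros a Ha. apply in_flat_map in Ha as (r & Hr & Ha).
        apply repeat_spec in Ha. apply in_seq in Hr. lia. }
      clear - Hb HW. induction Hb; cbn; auto. constructor; auto. now apply in_inner_Rg.
Qed.

End Words.

(** * Heaps *)

Definition hempty : heap := fun _ => None.
Definition cell_heap (a : loc) (v : list loc) : heap := fun l => if l =? a then Some v else None.
Definition hplus (h1 h2 : heap) : heap :=
  fun l => match h1 l with Some v => Some v | None => h2 l end.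

Definition hdisjoint (h1 h2 : heap) : Prop := forall l, h1 l = None \/ h2 l = None.

Lemma hunion_eq h1 h2 h : hunion h1 h2 h <-> hdisjoint h1 h2 /\ h = hplus h1 h2.
Proof.
  split.
  - intros H. split; [intros l; apply H|]. apply functional_extensionality. intros l. apply H.
  - intros [H ->] l. split; [apply H | reflexivity].
Qed.

Lemma hunion_plus h1 h2 : hdisjoint h1 h2 -> hunion h1 h2 (hplus h1 h2).
Proof. intros H. now apply hunion_eq. Qed.

Lemma hsingle_eq a v h : hsingle a v h <-> h = cell_heap a v.
Proof.
  split; [intros H; now apply functional_extensionality | intros ->; intros l; reflexivity].
Qed.

Lemma hunion_comm h1 h2 h : hunion h1 h2 h -> hunion h2 h1 h.
Proof.
  intros H l. destruct (H l) as [Hd ->]. destruct (h1 l), (h2 l); intuition discriminate.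
Qed.

Lemma hunion_assoc_r a b ab c h :
  hunion a b ab -> hunion ab c h -> hunion b c (hplus b c) /\ hunion a (hplus b c) h.
Proof.
  intros H1 H2. split.
  - apply hunion_plus. intros l. specialize (H1 l). specialize (H2 l).
    destruct H1 as [_ H1], H2 as [H2 _]. rewrite H1 in H2.
    destruct (a l), (b l), (c l); intuition discriminate.
  - intros l. specialize (H1 l). specialize (H2 l). unfold hplus.
    destruct H1 as [H1 H1'], H2 as [H2 H2']. rewrite H2'. rewrite H1' in *.
    destruct (a l), (b l), (c l); intuition discriminate.
Qed.

Lemma hunion_assoc_l a b bc c h :
  hunion b c bc -> hunion a bc h -> hunion a b (hplus a b) /\ hunion (hplus a b) c h.
Proof.
  intros H1 H2. apply hunion_comm in H1, H2.
  destruct (hunion_assoc_r _ _ _ _ _ H1 H2) as [H3 H4].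
  assert (Heq : hplus b a = hplus a b).
  { apply hunion_eq in H3 as [Hd _]. apply functional_extensionality. intros l.
    specialize (Hd l). unfold hplus. destruct (a l), (b l); intuition discriminate. }
  rewrite Heq in *. split; now apply hunion_comm.
Qed.

Lemma hunion_empty_r a h : hunion a hempty h <-> h = a.
Proof.
  split.
  - intros H. apply hunion_eq in H as [_ ->]. apply functional_extensionality. intros l.
    unfold hplus. now destruct (a l).
  - intros -> l. split; [now right | now destruct (a l)].
Qed.

Lemma hunion_none h1 h2 h l : hunion h1 h2 h -> h l = None -> h1 l = None /\ h2 l = None.
Proof. intros H E. destruct (H l) as [_ H']. rewrite E in H'. now destruct (h1 l). Qed.

(** * The rules of an automaton *)

Definition code_eff (e : eff) : nat :=
  match e with
  | EKeep => cpair 0 0 | EInc r => cpair 1 r | EDec r => cpair 2 r | EZero r => cpair 3 r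
  end.

Definition index (l : letter) : nat :=
  match l with
  | Fin => cpair 0 0
  | Tr (q, e, q') => cpair 1 (cpair q (cpair (code_eff e) q'))
  | Rg m => cpair 2 m
  end.

Lemma index_inj l l' : index l = index l' -> l = l'.
Proof.
  destruct l as [|[[q e] q1]|m], l' as [|[[q' e'] q1']|m']; cbn [index]; intros H;
    apply cpair_inj in H as [H1 H2]; try discriminate; [reflexivity | | now subst].
  apply cpair_inj in H2 as [-> H2]. apply cpair_inj in H2 as [H2 ->].
  do 2 f_equal. f_equal.
  destruct e, e'; cbn [code_eff] in H2; apply cpair_inj in H2 as [? ?]; subst; congruence.
Qed.

Definition code1 (i : st1) : nat :=
  match i with
  | Start => cpair 0 0 | Words => cpair 1 0 | Scan => cpair 2 0 | Any => cpair 3 0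
  | Dst q => cpair 4 q | Pos m => cpair 5 m
  | More m k => cpair 6 (cpair m k) | NoMore m => cpair 7 m
  end.

Definition code2 (z : st2) : nat :=
  match z with
  | LeL m k => cpair 0 (cpair m k) | LeR m k => cpair 1 (cpair m k)
  | GeL m k => cpair 2 (cpair m k) | GeR m => cpair 3 m
  end.

Ltac code_inj :=
  repeat match goal with
  | H : cpair _ _ = cpair _ _ |- _ => apply cpair_inj in H as [? ?]
  end; congruence.

Lemma code1_inj i i' : code1 i = code1 i' -> i = i'.
Proof. destruct i, i'; cbn [code1]; intros H; code_inj. Qed.

Lemma code2_inj z z' : code2 z = code2 z' -> z = z'.
Proof. destruct z, z'; cbn [code2]; intros H; code_inj. Qed.

Section Rules.

Context (kappa : nat).
Context (T : list trans) (K : nat) (qf : nat).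

(** A bound on the indices, not the number of letters: the parameter of a letter is then determined
    by its index alone. *)
Definition alphabet_size : nat := S (list_max (map index (letters T K))).

Local Notation N := alphabet_size.

Lemma index_lt l : In l (letters T K) -> index l < N.
Proof.
  intros Hl. unfold alphabet_size.
  assert (H : Forall (fun k => k <= list_max (map index (letters T K))) (map index (letters T K)))
    by (apply list_max_le; lia).
  rewrite Forall_forall in H. specialize (H _ (in_map index _ _ Hl)). lia.
Qed.

(* In every rule the variables 0, 1, 2 are the first head, the second head and
   the end of the left segment; 3 and 4 are existential, and [5 + n] is the
   parameter that stands for the letter of index [n]. *)
Definition letter_var (l : letter) : var := 5 + index l.
Definition letter_vars : list var := map (fun n => 5 + n) (seq 0 N).

Definition cell (x : var) (y : term) (l : letter) : atom :=
  APto x (y :: TVar (letter_var l) :: repeat TBot (kappa - 2)).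

(** The codes of the two kinds of states overlap; the arities keep the predicates apart. *)
Definition pred1 (i : st1) : psym := (code1 i, 1 + N).
Definition pred2 (z : st2) : psym := (code2 z, 3 + N).

Definition call1 (i : st1) (x : var) : atom := APred (pred1 i) (x :: letter_vars).
(** The head that reads next comes first, since a progressing rule allocates its first parameter. *)
Definition call2 (z : st2) (left right mid : var) : atom :=
  APred (pred2 z)
    (if reads_left z then left :: right :: mid :: letter_vars
     else right :: left :: mid :: letter_vars).

(** In a fork, variable 4 is the guess. It is passed twice: as the start of the right head and as
    the place where the left head must arrive. *)
Definition rule1 (i : st1) (e : letter * target1) : rule :=
  let (l, tgt) := e in
  match tgt with
  | ToEnd => mkRule (pred1 i) (0 :: letter_vars) (cell 0 TBot l) []
  | To j => mkRule (pred1 i) (0 :: letter_vars) (cell 0 (TVar 3) l) [call1 j 3]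
  | Fork z => mkRule (pred1 i) (0 :: letter_vars) (cell 0 (TVar 3) l) [call2 z 3 4 4]
  end.

(** In [LeftDone] the last cell on the left points to 2, which confirms the guess. Connectedness is
    lost when the call starts at 1, the head that has not just moved: the cell read does not point
    there. *)
Definition rule2 (z : st2) (e : letter * target2) : rule :=
  let (l, tgt) := e in
  match tgt with
  | To2 z' =>
      mkRule (pred2 z) (0 :: 1 :: 2 :: letter_vars) (cell 0 (TVar 3) l)
        [if reads_left z then call2 z' 3 1 2 else call2 z' 1 3 2]
  | LeftDone j =>
      mkRule (pred2 z) (0 :: 1 :: 2 :: letter_vars) (cell 0 (TVar 2) l) [call1 j 1]
  end.

Definition rules : sid :=
  flat_map (fun i => map (rule1 i) (out1 T K qf i)) (states1 T K) ++
  flat_map (fun z => map (rule2 z) (out2 T K z)) (states2 K).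

Lemma in_rules r : In r rules <->
  (exists i e, In i (states1 T K) /\ In e (out1 T K qf i) /\ r = rule1 i e) \/
  (exists z e, In z (states2 K) /\ In e (out2 T K z) /\ r = rule2 z e).
Proof.
  unfold rules. rewrite in_app_iff, !in_flat_map. split.
  - intros [(i & Hi & H)|(i & Hi & H)]; apply in_map_iff in H as (e & <- & He); eauto 8.
  - intros [(i & e & Hi & He & ->)|(i & e & Hi & He & ->)]; [left|right]; exists i;
      (split; [assumption|]; now apply in_map).
Qed.

Definition cell_value (lv : nat -> loc) (y : loc) (l : letter) : list loc :=
  y :: lv (index l) :: repeat lbot (kappa - 2).

Fixpoint segment (lv : nat -> loc) (x : loc) (W : list letter) (z : loc) (h : heap) : Prop :=
  match W with
  | [] => x = z /\ h = hempty
  | l :: W' => exists y h', hunion (cell_heap x (cell_value lv y l)) h' h /\ segment lv y W' z h'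
  end.

Lemma segment_app lv U V : forall x z h,
  segment lv x (U ++ V) z h <->
  exists y h1 h2, hunion h1 h2 h /\ segment lv x U y h1 /\ segment lv y V z h2.
Proof.
  induction U as [|l U IH]; intros x z h; cbn [app segment].
  - split.
    + intros H. exists x, hempty, h. split; [|now split].
      apply hunion_comm. now apply hunion_empty_r.
    + intros (y & h1 & h2 & Hu & [-> ->] & H).
      apply hunion_comm, hunion_empty_r in Hu. now subst.
  - split.
    + intros (y & h' & Hu & H). apply IH in H as (w & h1 & h2 & Hu' & H1 & H2).
      destruct (hunion_assoc_l _ _ _ _ _ Hu' Hu) as [Ha Hb]. exists w. eauto 8.
    + intros (w & h1 & h2 & Hu & (y & h' & Hu' & H1) & H2).
      destruct (hunion_assoc_r _ _ _ _ _ Hu' Hu) as [Ha Hb]. exists y, (hplus h' h2).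
      split; [assumption|]. apply IH. eauto 8.
Qed.

Lemma segment_head lv x l W z h : segment lv x (l :: W) z h -> h lbot = None -> x <> lbot.
Proof.
  intros (y & h' & Hu & _) Hb ->. apply (hunion_none _ _ _ _ Hu) in Hb as [Hb _].
  discriminate.
Qed.

(** A heap spells one word only from a given location. Agreement of the two heaps is assumed instead
    of equality because it passes at once to the heaps without the first cell; both words stop
    together because [lbot] is never allocated. *)
Lemma segment_unique lv W : forall W' x h h',
  (forall l l', In l W -> lv (index l) = lv (index l') -> l = l') ->
  segment lv x W lbot h -> segment lv x W' lbot h' ->
  (forall l v v', h l = Some v -> h' l = Some v' -> v = v') ->
  h lbot = None -> h' lbot = None -> W = W'.
Proof.
  induction W as [|l W IH]; intros [|l' W'] x h h' Hinj H1 H2 Hag Hb Hb'.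
  - reflexivity.
  - destruct H1 as [-> ->]. now apply segment_head in H2.
  - destruct H2 as [-> ->]. now apply segment_head in H1.
  - destruct H1 as (y & g & Hu & H1), H2 as (y' & g' & Hu' & H2).
    pose proof (hunion_none _ _ _ _ Hu Hb) as [_ Hg].
    pose proof (hunion_none _ _ _ _ Hu' Hb') as [_ Hg'].
    assert (Hv : cell_value lv y l = cell_value lv y' l').
    { apply (Hag x).
      - destruct (Hu x) as [_ ->]. unfold cell_heap. now rewrite Nat.eqb_refl.
      - destruct (Hu' x) as [_ ->]. unfold cell_heap. now rewrite Nat.eqb_refl. }
    injection Hv as -> Hl. apply Hinj in Hl as ->; [|now left]. f_equal.
    apply (IH W' y' g g'); auto.
    + intros k k' Hk. apply Hinj. now right.
    + intros a v v' Ha Ha'. apply (Hag a).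
      * destruct (Hu a) as [[E|E] ->]; [now rewrite E | congruence].
      * destruct (Hu' a) as [[E|E] ->]; [now rewrite E | congruence].
Qed.

(** * Soundness: models spell accepted words *)

(** The default must differ from [lbot]: [acc_sat] requires a legal location at every index, also
    beyond the list. *)
Definition value_of (ls : list loc) (n : nat) : loc := nth n ls 1.

Definition pred_meaning (p : psym) (ls : list loc) (h : heap) : Prop :=
  (forall i x ps, p = pred1 i -> ls = x :: ps ->
     exists W, acc1 T K qf i W /\ segment (value_of ps) x W lbot h) /\
  (forall z a b m ps, p = pred2 z -> ls = a :: b :: m :: ps ->
     exists U V h1 h2, acc2 T K qf z U V /\ hunion h1 h2 h /\
       segment (value_of ps) (if reads_left z then a else b) U m h1 /\
       segment (value_of ps) (if reads_left z then b else a) V lbot h2).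

(** The construction uses only points-to atoms, predicate atoms and stars; nothing is claimed of the
    other formulas. *)
Fixpoint meaning (s : store) (h : heap) (f : form) : Prop :=
  match f with
  | FAtom (APto x ys) =>
      exists a vs, s x = Some a /\ map (eval_term s) ys = map Some vs /\ h = cell_heap a vs
  | FAtom (APred p us) => exists ls, map s us = map Some ls /\ pred_meaning p ls h
  | FStar f g => exists h1 h2, hunion h1 h2 h /\ meaning s h1 f /\ meaning s h2 g
  | _ => True
  end.

Lemma map_Some_inj A (l l' : list A) : map Some l = map Some l' -> l = l'.
Proof.
  revert l'. induction l; intros [|]; cbn; intros H; try discriminate; [reflexivity|].
  injection H as -> H. f_equal. auto.
Qed.

Lemma letter_var_value (s : store) ps l :
  map s letter_vars = map Some ps -> In l (letters T K) ->
  s (letter_var l) = Some (value_of ps (index l)).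
Proof.
  intros H Hl. apply index_lt in Hl. unfold letter_vars in H. rewrite map_map in H.
  assert (length ps = N) by (apply (f_equal (@length _)) in H; now rewrite !length_map, length_seq in H).
  pose proof (f_equal (fun L => nth_error L (index l)) H) as E. cbn beta in E.
  rewrite !nth_error_map, nth_error_seq in E.
  destruct (Nat.ltb_spec (index l) N); [|lia]. cbn in E.
  unfold letter_var, value_of. destruct (nth_error ps (index l)) as [v|] eqn:Ev; [|discriminate].
  erewrite nth_error_nth by eassumption. cbn in E. now injection E.
Qed.

Lemma cell_meaning s h x y l ps :
  map s letter_vars = map Some ps -> In l (letters T K) ->
  meaning s h (FAtom (cell x y l)) ->
  exists a b, s x = Some a /\ eval_term s y = Some b /\
    h = cell_heap a (cell_value (value_of ps) b l).
Proof.
  intros Hs Hl (a & vs & Hx & Hv & ->).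
  destruct vs as [|b [|c vs]]; try discriminate. injection Hv as Hy Hc Hr.
  exists a, b. repeat split; auto. f_equal. unfold cell_value.
  rewrite (letter_var_value s ps l Hs Hl) in Hc. injection Hc as <-. do 2 f_equal.
  apply map_Some_inj. rewrite <- Hr, !map_repeat. reflexivity.
Qed.

Lemma call1_meaning s h j x b ps :
  map s letter_vars = map Some ps -> s x = Some b -> meaning s h (FAtom (call1 j x)) ->
  exists W, acc1 T K qf j W /\ segment (value_of ps) b W lbot h.
Proof.
  intros Hs Hx (ls & Hls & [H _]). cbn [map] in Hls. rewrite Hx, Hs in Hls.
  change (Some b :: map Some ps) with (map Some (b :: ps)) in Hls.
  apply map_Some_inj in Hls. exact (H j b ps eq_refl (eq_sym Hls)).
Qed.

Lemma call2_meaning s h z p r m ps a b c :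
  map s letter_vars = map Some ps -> s p = Some a -> s r = Some b -> s m = Some c ->
  meaning s h (FAtom (call2 z p r m)) ->
  exists U V h1 h2, acc2 T K qf z U V /\ hunion h1 h2 h /\
    segment (value_of ps) a U c h1 /\ segment (value_of ps) b V lbot h2.
Proof.
  intros Hs Hp Hr Hm (ls & Hls & [_ H]). specialize (H z).
  destruct (reads_left z); cbn [map] in Hls; rewrite Hp, Hr, Hm, Hs in Hls.
  - change (map Some (a :: b :: c :: ps) = map Some ls) in Hls.
    apply map_Some_inj in Hls. exact (H a b c ps eq_refl (eq_sym Hls)).
  - change (map Some (b :: a :: c :: ps) = map Some ls) in Hls.
    apply map_Some_inj in Hls. exact (H b a c ps eq_refl (eq_sym Hls)).
Qed.

Lemma call2_defined s h z p r m :
  meaning s h (FAtom (call2 z p r m)) ->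
  exists a b c, s p = Some a /\ s r = Some b /\ s m = Some c.
Proof.
  intros (ls & Hls & _).
  destruct (reads_left z); destruct ls as [|a [|b [|c ls]]]; try discriminate;
    injection Hls as -> -> -> _; eauto 8.
Qed.

Lemma rule1_meaning t h i l tgt x ps :
  In i (states1 T K) -> In (l, tgt) (out1 T K qf i) ->
  map t (rparams (rule1 i (l, tgt))) = map Some (x :: ps) ->
  meaning t h (rbody_form (rule1 i (l, tgt))) ->
  exists W, acc1 T K qf i W /\ segment (value_of ps) x W lbot h.
Proof.
  intros Hi He Ht Hm. pose proof (out1_letter T K qf _ _ _ Hi He) as Hl.
  assert (t 0 = Some x /\ map t letter_vars = map Some ps) as [H0 Hps]
    by (destruct tgt; injection Ht as H0 Hps; auto).
  clear Ht. destruct tgt as [|j|z]; cbn [rule1 rbody_form rfirst rrest star_of] in Hm.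
  - apply (cell_meaning _ _ _ _ _ ps) in Hm as (a & b & Ha & Hb & ->); auto.
    exists [l]. split; [now apply acc_end|].
    rewrite H0 in Ha. injection Ha as <-. injection Hb as <-.
    exists lbot, hempty. split; [now apply hunion_empty_r | now split].
  - destruct Hm as (h1 & h2 & Hu & H1 & H2).
    apply (cell_meaning _ _ _ _ _ ps) in H1 as (a & b & Ha & Hb & ->); auto.
    rewrite H0 in Ha. injection Ha as <-.
    apply (call1_meaning _ _ _ _ b ps) in H2 as (W & HW & Hseg); auto.
    exists (l :: W). split; [now apply acc_to with j|]. exists b, h2. auto.
  - destruct Hm as (h1 & h2 & Hu & H1 & H2).
    apply (cell_meaning _ _ _ _ _ ps) in H1 as (a & b & Ha & Hb & ->); auto.
    rewrite H0 in Ha. injection Ha as <-.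
    destruct (call2_defined _ _ _ _ _ _ H2) as (b' & c & c' & Hb' & Hc & Hc').
    cbn in Hb. rewrite Hb in Hb'. injection Hb' as <-. rewrite Hc in Hc'. injection Hc' as <-.
    apply (call2_meaning _ _ _ _ _ _ ps b c c) in H2 as (U & V & g1 & g2 & Hacc & Hg & HU & HV);
      auto.
    exists (l :: U ++ V). split; [now apply acc_fork with z|].
    exists b, h2. split; [assumption|]. apply segment_app. eauto 6.
Qed.

Lemma rule2_meaning t h z l tgt x y m ps :
  In z (states2 K) -> In (l, tgt) (out2 T K z) ->
  map t (rparams (rule2 z (l, tgt))) = map Some (x :: y :: m :: ps) ->
  meaning t h (rbody_form (rule2 z (l, tgt))) ->
  exists U V h1 h2, acc2 T K qf z U V /\ hunion h1 h2 h /\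
    segment (value_of ps) (if reads_left z then x else y) U m h1 /\
    segment (value_of ps) (if reads_left z then y else x) V lbot h2.
Proof.
  intros Hz He Ht Hm. pose proof (out2_letter T K _ _ _ Hz He) as Hl.
  assert (t 0 = Some x /\ t 1 = Some y /\ t 2 = Some m /\ map t letter_vars = map Some ps)
    as (H0 & H1 & H2 & Hps) by (destruct tgt; injection Ht as H0 H1 H2 Hps; auto).
  clear Ht. destruct tgt as [z'|j]; cbn [rule2 rbody_form rfirst rrest star_of] in Hm;
    destruct Hm as (h1 & h2 & Hu & Hc & Hcall);
    apply (cell_meaning _ _ _ _ _ ps) in Hc as (a & b & Ha & Hb & ->); auto;
    rewrite H0 in Ha; injection Ha as <-; cbn in Hb.
  - destruct (reads_left z) eqn:Hside.
    + apply (call2_meaning _ _ _ _ _ _ ps b y m) in Hcall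
        as (U & V & g1 & g2 & Hacc & Hg & HU & HV); auto.
      destruct (hunion_assoc_l _ _ _ _ _ Hg Hu) as [Hg1 Hg2].
      exists (l :: U), V, (hplus (cell_heap x (cell_value (value_of ps) b l)) g1), g2.
      split; [now apply acc_left with z'|]. split; [assumption|]. split; [|assumption].
      exists b, g1. auto.
    + apply (call2_meaning _ _ _ _ _ _ ps y b m) in Hcall
        as (U & V & g1 & g2 & Hacc & Hg & HU & HV); auto.
      apply hunion_comm in Hg.
      destruct (hunion_assoc_l _ _ _ _ _ Hg Hu) as [Hg1 Hg2].
      exists U, (l :: V), g1, (hplus (cell_heap x (cell_value (value_of ps) b l)) g2).
      split; [now apply acc_right with z'|]. split; [now apply hunion_comm|].
      split; [assumption|]. exists b, g2. auto.
  - assert (Hside : reads_left z = true).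
    { destruct z as [| |? []|]; try reflexivity; exfalso; cbn [out2] in He;
        repeat (apply in_app_iff in He || destruct He as [He|He] || inversion He);
        apply in_map_iff in He as (? & He & _); discriminate. }
    rewrite Hside. rewrite H2 in Hb. injection Hb as <-.
    apply (call1_meaning _ _ _ _ y ps) in Hcall as (W & HW & Hseg); auto.
    exists [l], W, (cell_heap x (cell_value (value_of ps) m l)), h2.
    split; [now apply acc_left_done with j|]. split; [assumption|]. split; [|assumption].
    exists m, hempty. split; [now apply hunion_empty_r | now split].
Qed.

Lemma sat_meaning s h f : sat rules s h f -> meaning s h f.
Proof.
  induction 1 as [ | | s h x ys a vs Hx Hys Hh | s h p us ls r t Hus Hr Hp Ht Htp Hsat IH
                 | s h h1 h2 f g Hu _ IH1 _ IH2 | | | ]; cbn [meaning]; auto.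
  - exists a, vs. now rewrite <- hsingle_eq.
  - exists ls. split; [assumption|].
    apply in_rules in Hr as [(i & [l tgt] & Hi & He & ->)|(z & [l tgt] & Hz & He & ->)]; split.
    + intros i' x ps -> ->.
      assert (i = i') as <- by (apply code1_inj; destruct tgt; exact (f_equal fst Hp)).
      now apply rule1_meaning with t l tgt.
    + intros z a b m ps -> _. exfalso. destruct tgt; apply (f_equal snd) in Hp; cbn in Hp; lia.
    + intros i x ps -> _. exfalso. destruct tgt; apply (f_equal snd) in Hp; cbn in Hp; lia.
    + intros z' a b m ps -> ->.
      assert (z = z') as <- by (apply code2_inj; destruct tgt; exact (f_equal fst Hp)).
      now apply rule2_meaning with t l tgt.
  - eauto 6.
Qed.

(** * Completeness: accepted words have models *)

Definition rule_store (lv : nat -> loc) (o : list loc) : store :=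
  fun v => if v <? 5 then nth_error o v else Some (lv (v - 5)).

Definition letter_values (lv : nat -> loc) : list loc := map lv (seq 0 N).

Lemma rule_store_letter lv o l : rule_store lv o (letter_var l) = Some (lv (index l)).
Proof.
  unfold rule_store, letter_var. destruct (Nat.ltb_spec (5 + index l) 5); [lia|].
  do 2 f_equal. lia.
Qed.

Lemma rule_store_letters lv o : map (rule_store lv o) letter_vars = map Some (letter_values lv).
Proof.
  unfold letter_vars, letter_values. rewrite !map_map. apply map_ext. intros n.
  unfold rule_store. destruct (Nat.ltb_spec (5 + n) 5); [lia|]. do 2 f_equal. lia.
Qed.

Lemma rule_store_valid lv o :
  (forall n, lv n <> lbot) -> Forall (fun l => l <> lbot) o -> valid_store (rule_store lv o).
Proof.
  intros Hlv Ho v l. unfold rule_store. destruct (v <? 5).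
  - intros H. rewrite Forall_forall in Ho. apply Ho. eapply nth_error_In. eassumption.
  - intros [= <-]. apply Hlv.
Qed.

Lemma sat_cell lv s x y l a b :
  s x = Some a -> eval_term s y = Some b -> s (letter_var l) = Some (lv (index l)) ->
  sat rules s (cell_heap a (cell_value lv b l)) (FAtom (cell x y l)).
Proof.
  intros Hx Hy Hl. apply sat_pto with a (cell_value lv b l); [assumption | | now apply hsingle_eq].
  unfold cell_value. cbn [map eval_term]. rewrite Hy, Hl, !map_repeat. reflexivity.
Qed.

Lemma acc1_nonempty i W : acc1 T K qf i W -> exists l W', W = l :: W'.
Proof. intros []; eauto. Qed.

(** Each head still has a letter to read, so its location is allocated and differs from [lbot], as
    the value of a variable must. *)
Lemma acc2_right_nonempty z U V : acc2 T K qf z U V -> exists l V', V = l :: V'.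
Proof. induction 1; eauto. now apply acc1_nonempty with j. Qed.

Lemma acc1_head lv i W x z h :
  acc1 T K qf i W -> segment lv x W z h -> h lbot = None -> x <> lbot.
Proof. intros Hi. apply acc1_nonempty in Hi as (l & W' & ->). apply segment_head. Qed.

Lemma acc2_head lv z U V x y h :
  acc2 T K qf z U V -> segment lv x V y h -> h lbot = None -> x <> lbot.
Proof. intros Hz. apply acc2_right_nonempty in Hz as (l & W' & ->). apply segment_head. Qed.

Lemma acc2_left_head lv z U V x y h :
  acc2 T K qf z U V -> segment lv x U y h -> h lbot = None -> x <> lbot.
Proof.
  intros Hz. assert (exists l U', U = l :: U') as (l & U' & ->) by (induction Hz; eauto).
  apply segment_head.
Qed.

Lemma sat_rule s h us ls r lv o :
  In r rules -> map s us = map Some ls ->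
  (forall n, lv n <> lbot) -> Forall (fun l => l <> lbot) o ->
  map (rule_store lv o) (rparams r) = map Some ls ->
  sat rules (rule_store lv o) h (rbody_form r) -> sat rules s h (FAtom (APred (rhead r) us)).
Proof.
  intros. eapply sat_pred; try eassumption; [reflexivity|]. now apply rule_store_valid.
Qed.

Lemma acc_sat lv : (forall n, lv n <> lbot) ->
  (forall i W, acc1 T K qf i W -> forall s h x us,
     segment lv x W lbot h -> h lbot = None ->
     map s us = map Some (x :: letter_values lv) ->
     sat rules s h (FAtom (APred (pred1 i) us))) /\
  (forall z U V, acc2 T K qf z U V -> forall s h h1 h2 a b m us,
     hunion h1 h2 h -> h lbot = None ->
     segment lv a U m h1 -> segment lv b V lbot h2 -> m <> lbot ->
     map s us = map Some ((if reads_left z then [a; b; m] else [b; a; m]) ++ letter_values lv) ->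
     sat rules s h (FAtom (APred (pred2 z) us))).
Proof.
  intros Hlv.
  assert (Hmap : forall o x y, rule_store lv o x = Some y ->
    map (rule_store lv o) (x :: letter_vars) = map Some (y :: letter_values lv)).
  { intros o x y H. cbn [map]. now rewrite H, rule_store_letters. }
  apply acc_mut.
  - intros i l Hi He s h x us Hseg Hb Hus.
    pose proof (segment_head _ _ _ _ _ _ Hseg Hb) as Hx.
    destruct Hseg as (y & h' & Hu & -> & ->). apply hunion_empty_r in Hu as ->.
    eapply (sat_rule s _ us _ (rule1 i (l, ToEnd)) lv [x]);
      [ | exact Hus | exact Hlv | auto 7 | | ].
    + apply in_rules. left. eauto.
    + now apply Hmap.
    + apply sat_cell; [reflexivity | reflexivity | apply rule_store_letter].
  - intros i l j W Hi He Hacc IH s h x us Hseg Hb Hus.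
    pose proof (segment_head _ _ _ _ _ _ Hseg Hb) as Hx.
    destruct Hseg as (y & h' & Hu & Hseg).
    pose proof (hunion_none _ _ _ _ Hu Hb) as [_ Hb'].
    pose proof (acc1_head _ _ _ _ _ _ Hacc Hseg Hb') as Hy.
    (* Variables 1 and 2 do not occur in this rule; the repeated [x] only moves [y] to position
       3. *)
    eapply (sat_rule s _ us _ (rule1 i (l, To j)) lv [x; x; x; y]);
      [ | exact Hus | exact Hlv | auto 7 | | ].
    + apply in_rules. left. eauto.
    + now apply Hmap.
    + eapply sat_star; [exact Hu | |].
      * apply sat_cell; [reflexivity | reflexivity | apply rule_store_letter].
      * apply IH with y; auto.
  - intros i l z U V Hi He Hacc IH s h x us Hseg Hb Hus.
    pose proof (segment_head _ _ _ _ _ _ Hseg Hb) as Hx.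
    destruct Hseg as (y & h' & Hu & Hseg).
    pose proof (hunion_none _ _ _ _ Hu Hb) as [_ Hb'].
    apply segment_app in Hseg as (w & h1 & h2 & Hu' & H1 & H2).
    pose proof (hunion_none _ _ _ _ Hu' Hb') as [Hb1 Hb2].
    pose proof (acc2_left_head _ _ _ _ _ _ _ Hacc H1 Hb1) as Hy.
    pose proof (acc2_head _ _ _ _ _ _ _ Hacc H2 Hb2) as Hw.
    eapply (sat_rule s _ us _ (rule1 i (l, Fork z)) lv [x; x; x; y; w]);
      [ | exact Hus | exact Hlv | auto 7 | | ].
    + apply in_rules. left. eauto.
    + now apply Hmap.
    + eapply sat_star; [exact Hu | |].
      * apply sat_cell; [reflexivity | reflexivity | apply rule_store_letter].
      * apply IH with h1 h2 y w w; auto.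
        destruct (reads_left z); cbn [map app]; now rewrite rule_store_letters.
  - intros z l z' U V Hz Hside He Hacc IH s h h1 h2 a b m us Hu Hb H1 H2 Hm Hus.
    rewrite Hside in Hus.
    pose proof (hunion_none _ _ _ _ Hu Hb) as [Hb1 Hb2].
    pose proof (segment_head _ _ _ _ _ _ H1 Hb1) as Ha.
    pose proof (acc2_head _ _ _ _ _ _ _ Hacc H2 Hb2) as Hbn.
    destruct H1 as (y & h' & Hu' & H1).
    pose proof (hunion_none _ _ _ _ Hu' Hb1) as [_ Hb1'].
    pose proof (acc2_left_head _ _ _ _ _ _ _ Hacc H1 Hb1') as Hy.
    destruct (hunion_assoc_r _ _ _ _ _ Hu' Hu) as [Hu1 Hu2].
    pose proof (hunion_none _ _ _ _ Hu2 Hb) as [_ Hb3].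
    eapply (sat_rule s _ us _ (rule2 z (l, To2 z')) lv [a; b; m; y]);
      [ | exact Hus | exact Hlv | auto 7 | | ].
    + apply in_rules. right. eauto.
    + cbn [map rparams rule2 app]. now rewrite rule_store_letters.
    + eapply sat_star; [exact Hu2 | |].
      * apply sat_cell; [reflexivity | reflexivity | apply rule_store_letter].
      * rewrite Hside. apply IH with h' h2 y b m; auto.
        destruct (reads_left z'); cbn [map app]; now rewrite rule_store_letters.
  - intros z l z' U V Hz Hside He Hacc IH s h h1 h2 a b m us Hu Hb H1 H2 Hm Hus.
    rewrite Hside in Hus.
    pose proof (hunion_none _ _ _ _ Hu Hb) as [Hb1 Hb2].
    pose proof (segment_head _ _ _ _ _ _ H2 Hb2) as Hbn.
    pose proof (acc2_left_head _ _ _ _ _ _ _ Hacc H1 Hb1) as Ha.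
    destruct H2 as (y & h' & Hu' & H2).
    pose proof (hunion_none _ _ _ _ Hu' Hb2) as [_ Hb2'].
    pose proof (acc2_head _ _ _ _ _ _ _ Hacc H2 Hb2') as Hy.
    destruct (hunion_assoc_r _ _ _ _ _ Hu' (hunion_comm _ _ _ Hu)) as [Hu1 Hu2].
    pose proof (hunion_none _ _ _ _ Hu2 Hb) as [_ Hb3].
    eapply (sat_rule s _ us _ (rule2 z (l, To2 z')) lv [b; a; m; y]);
      [ | exact Hus | exact Hlv | auto 7 | | ].
    + apply in_rules. right. eauto.
    + cbn [map rparams rule2 app]. now rewrite rule_store_letters.
    + eapply sat_star; [exact Hu2 | |].
      * apply sat_cell; [reflexivity | reflexivity | apply rule_store_letter].
      * rewrite Hside. apply IH with h1 h' a y m; auto; [now apply hunion_comm|].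
        destruct (reads_left z'); cbn [map app]; now rewrite rule_store_letters.
  - intros z l j V Hz Hside He Hacc IH s h h1 h2 a b m us Hu Hb H1 H2 Hm Hus.
    rewrite Hside in Hus.
    pose proof (hunion_none _ _ _ _ Hu Hb) as [Hb1 Hb2].
    pose proof (segment_head _ _ _ _ _ _ H1 Hb1) as Ha.
    pose proof (acc1_head _ _ _ _ _ _ Hacc H2 Hb2) as Hbn.
    destruct H1 as (y & h' & Hu' & -> & ->). apply hunion_empty_r in Hu' as ->.
    eapply (sat_rule s _ us _ (rule2 z (l, LeftDone j)) lv [a; b; m]);
      [ | exact Hus | exact Hlv | auto 7 | | ].
    + apply in_rules. right. eauto.
    + cbn [map rparams rule2 app]. now rewrite rule_store_letters.
    + eapply sat_star; [exact Hu | |].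
      * apply sat_cell; [reflexivity | reflexivity | apply rule_store_letter].
      * apply IH with b; auto.
Qed.

(** * Syntactic conditions *)

Lemma letter_vars_ge v : In v letter_vars -> 5 <= v.
Proof. intros H. apply in_map_iff in H as (n & <- & _). lia. Qed.

Lemma letter_vars_NoDup : NoDup letter_vars.
Proof.
  apply FinFun.Injective_map_NoDup; [intros x y; lia | apply seq_NoDup].
Qed.

Lemma letter_vars_length : length letter_vars = N.
Proof. unfold letter_vars. now rewrite length_map, length_seq. Qed.

Lemma letter_var_in l : In l (letters T K) -> In (letter_var l) letter_vars.
Proof.
  intros H. apply in_map_iff. exists (index l). split; [reflexivity|].
  apply in_seq. apply index_lt in H. lia.
Qed.

Lemma cell_wf x y l : 2 <= kappa -> wf_atom kappa (cell x y l).
Proof. intros H. cbn. rewrite repeat_length. lia. Qed.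

Lemma call1_wf j x : wf_atom kappa (call1 j x).
Proof. exact (f_equal S letter_vars_length). Qed.

Lemma call2_wf z p r m : wf_atom kappa (call2 z p r m).
Proof.
  unfold call2. destruct (reads_left z); exact (f_equal (fun n => 3 + n) letter_vars_length).
Qed.

Lemma rules_wf : 2 <= kappa -> wf_sid kappa rules.
Proof.
  intros Hkappa.
  pose proof letter_vars_NoDup as Hnd. pose proof letter_vars_length as Hlen.
  assert (Hge : forall v, v < 5 -> ~ In v letter_vars)
    by (intros v Hv H; apply letter_vars_ge in H; lia).
  apply Forall_forall. intros r Hr.
  apply in_rules in Hr as [(i & [l tgt] & _ & _ & ->)|(z & [l tgt] & _ & _ & ->)].
  - assert (H : NoDup (0 :: letter_vars)) by (constructor; auto with arith).
    destruct tgt; (split; [exact H|]; split; [cbn [rparams rule1 rule2 length rhead ar pred1 pred2 snd]; lia|]);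
      repeat (apply Forall_cons; [first [now apply cell_wf | apply call1_wf | apply call2_wf]|]);
      apply Forall_nil.
  - assert (H : NoDup (0 :: 1 :: 2 :: letter_vars)).
    { repeat (apply NoDup_cons; [cbn [In]; intuition (try discriminate);
        match goal with H : In ?v letter_vars |- _ => apply (Hge v); [lia | exact H] end|]).
      exact Hnd. }
    destruct tgt; (split; [exact H|]; split; [cbn [rparams rule1 rule2 length rhead ar pred1 pred2 snd]; lia|]);
      (apply Forall_cons; [now apply cell_wf|]); (apply Forall_cons; [|apply Forall_nil]);
      [destruct (reads_left z); apply call2_wf | apply call1_wf].
Qed.

Lemma rules_progressing r : In r rules -> progressing r.
Proof.
  intros Hr. apply in_rules in Hr as [(i & [l tgt] & _ & _ & ->)|(z & [l tgt] & _ & _ & ->)];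
    destruct tgt; do 4 eexists; (split; [reflexivity|]; split; [apply Permutation_refl|]);
    intros a Ha; cbn [rrest rule1 rule2 In] in Ha; try destruct (reads_left z);
    intuition (subst; auto).
Qed.

(* The positions whose argument is allocated by every unfolding: the first one
   and, for two-headed predicates (recognized by their arity), the second one. *)
Definition live (A : list atom) (e : var) : Prop :=
  (exists ys, In (APto e ys) A) \/
  (exists p us, In (APred p (e :: us)) A) \/
  (exists p u us, snd p = 3 + N /\ In (APred p (u :: e :: us)) A).

Lemma rename_call2 sg z p r m :
  exists us, rename_atom sg (call2 z p r m) =
    APred (pred2 z) (if reads_left z then sg p :: sg r :: us else sg r :: sg p :: us).
Proof. unfold call2. destruct (reads_left z); cbn; eauto. Qed.

Lemma live_call2 sg z p r m A e :
  In (rename_atom sg (call2 z p r m)) A -> e = sg p \/ e = sg r -> live A e.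
Proof.
  destruct (rename_call2 sg z p r m) as [us ->]. intros Ha He.
  destruct (reads_left z), He as [->| ->]; unfold live; eauto 8.
  - right. right. exists (pred2 z). eauto.
  - right. right. exists (pred2 z). eauto.
Qed.

(** A first argument is allocated by the rule itself. A second argument is the waiting head: it is
    passed on in one of the first two positions or, at [LeftDone], as the head of a one-headed
    predicate. *)
Lemma live_unfold A B e : unfold_step rules A B -> live A e -> live B e.
Proof.
  intros (A1 & A2 & p & us & r & sg & -> & Hr & <- & <- & _ & _ & ->) Hlive.
  assert (Hbody : forall a, In a (rbody r) ->
    In (rename_atom sg a) (A1 ++ map (rename_atom sg) (rbody r) ++ A2)).
  { intros a Ha. apply in_app_iff. right. apply in_app_iff. left. now apply in_map. }
  assert (Hkeep : forall a, In a (A1 ++ APred (rhead r) (map sg (rparams r)) :: A2) ->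
    a = APred (rhead r) (map sg (rparams r)) \/
    In a (A1 ++ map (rename_atom sg) (rbody r) ++ A2)).
  { intros a Ha. rewrite !in_app_iff. apply in_app_iff in Ha as [Ha|[Ha|Ha]]; auto. }
  set (B := A1 ++ map (rename_atom sg) (rbody r) ++ A2) in *. clearbody B.
  destruct Hlive as [(ys & Ha)|[(p & us & Ha)|(p & u & us & Hp & Ha)]];
    destruct (Hkeep _ Ha) as [Heq|Hin].
  - discriminate.
  - left. eauto.
  - injection Heq as _ Hps. left.
    destruct (rules_progressing r Hr) as (x1 & xs & ys & rho & Hps' & Hperm & _).
    rewrite Hps' in Hps. injection Hps as -> _.
    exists (map (rename_term sg) ys).
    apply (Hbody (APto x1 ys)). eapply Permutation_in; [symmetry; exact Hperm | now left].
  - right. left. eauto.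
  - injection Heq as -> Hps.
    apply in_rules in Hr as [(i & [l tgt] & _ & _ & ->)|(z & [l tgt] & _ & _ & ->)].
    + exfalso. destruct tgt; cbn in Hp; lia.
    + destruct tgt as [z'|j]; injection Hps as _ -> _.
      * assert (He : In (if reads_left z then call2 z' 3 1 2 else call2 z' 1 3 2)
                        (rbody (rule2 z (l, To2 z')))) by (right; now left).
        apply Hbody in He. destruct (reads_left z); eapply live_call2; eauto.
      * right. left. exists (pred1 j), (map sg letter_vars).
        apply (Hbody (call1 j 1)). right. now left.
  - right. right. eauto 6.
Qed.

Lemma live_unfolds A B e : unfolds rules A B -> live A e -> live B e.
Proof. induction 1; eauto using live_unfold. Qed.

Lemma rename_atom_id a : rename_atom (fun x => x) a = a.
Proof.
  destruct a as [| |x ys|p us]; cbn; try reflexivity; [|now rewrite map_id].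
  f_equal. rewrite <- map_id. apply map_ext. now intros [].
Qed.

Lemma fv_cell x y l v :
  In v (fv_atom (cell x y l)) -> v = x \/ In v (fv_term y) \/ v = letter_var l.
Proof.
  cbn. rewrite in_app_iff. intros [H|[H|[H|H]]]; auto. exfalso.
  apply in_flat_map in H as (t & Ht & H). apply repeat_spec in Ht. now subst.
Qed.

Lemma fv_call2 z p r m v :
  In v (fv_atom (call2 z p r m)) -> v = p \/ v = r \/ v = m \/ In v letter_vars.
Proof. unfold call2. cbn. destruct (reads_left z); cbn; intuition. Qed.

(** Every existential variable is handed to the call as a head, the guess 4 of a fork included. *)
Lemma existential_live r e : In r rules -> existential r e -> live (rbody r) e.
Proof.
  intros Hr [Hv Hp].
  assert (Hcall : forall z p q m, In (call2 z p q m) (rbody r) -> e = p \/ e = q -> live (rbody r) e).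
  { intros z p q m H. apply (live_call2 (fun x => x) z p q m). now rewrite rename_atom_id. }
  unfold vars_atoms in Hv. apply in_flat_map in Hv as (a & Ha & Hv).
  apply in_rules in Hr as [(i & [l tgt] & Hi & He & ->)|(z & [l tgt] & Hz & He & ->)].
  - apply out1_letter, letter_var_in in He; [|assumption].
    assert (Hl : ~ In e letter_vars) by (destruct tgt; cbn in Hp; intuition).
    assert (H0 : e <> 0) by (destruct tgt; cbn in Hp; intuition).
    assert (Hel : e <> letter_var l) by congruence.
    destruct tgt as [|j|z].
    + destruct Ha as [<-|[]]. apply fv_cell in Hv. cbn [In fv_atom call1 fv_term] in Hv. intuition congruence.
    + assert (e = 3) as ->.
      { destruct Ha as [<-|[<-|[]]]; [apply fv_cell in Hv | ]; cbn [In fv_atom call1 fv_term] in Hv; intuition congruence. }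
      right. left. exists (pred1 j), letter_vars. right. now left.
    + apply Hcall with z 3 4 4; [right; now left|].
      destruct Ha as [<-|[<-|[]]]; [apply fv_cell in Hv | apply fv_call2 in Hv];
        cbn [In fv_atom call1 fv_term] in Hv; intuition congruence.
  - apply out2_letter, letter_var_in in He; [|assumption].
    assert (Hl : ~ In e letter_vars) by (destruct tgt; cbn in Hp; intuition).
    assert (H0 : e <> 0 /\ e <> 1 /\ e <> 2) by (destruct tgt; cbn in Hp; intuition).
    assert (Hel : e <> letter_var l) by congruence.
    destruct tgt as [z'|j].
    + assert (e = 3) as ->.
      { destruct Ha as [<-|[<-|[]]]; [apply fv_cell in Hv; cbn [In fv_atom call1 fv_term] in Hv; intuition congruence |].
        destruct (reads_left z); apply fv_call2 in Hv; intuition. }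
      destruct (reads_left z) eqn:Hside.
      * apply Hcall with z' 3 1 2; [|now left]. right. left. now rewrite Hside.
      * apply Hcall with z' 1 3 2; [|now right]. right. left. now rewrite Hside.
    + exfalso. destruct Ha as [<-|[<-|[]]]; [apply fv_cell in Hv | ]; cbn [In fv_atom call1 fv_term] in Hv; intuition congruence.
Qed.

Lemma rules_established r : In r rules -> established rules r.
Proof.
  intros Hr B HB Hless e He.
  apply existential_live in He; [|assumption].
  apply (live_unfolds _ _ _ HB) in He as [(ys & H)|[(p & us & H)|(p & u & us & _ & H)]].
  - now apply alloc_pto with ys.
  - now apply Hless in H.
  - now apply Hless in H.
Qed.

(** The states whose predicates are reachable from phi, hence those that need connected rules. *)
Definition generator (i : st1) : Prop := i = Start \/ i = Words.

Lemma generator_rule r i :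
  In r rules -> rhead r = pred1 i -> generator i ->
  exists l, r = rule1 i (l, To Words) \/ r = rule1 i (l, ToEnd).
Proof.
  intros Hr Hhead Hi.
  apply in_rules in Hr as [(i' & [l tgt] & _ & He & ->)|(z & [l tgt] & _ & _ & ->)].
  - assert (i' = i) as -> by (apply code1_inj; destruct tgt; exact (f_equal fst Hhead)).
    exists l. destruct Hi as [-> | ->]; cbn [out1] in He.
    + apply in_map_iff in He as (? & He & _). injection He as <- <-. auto.
    + destruct He as [He|He]; [injection He as <- <-; auto|].
      apply in_map_iff in He as (? & He & _). injection He as <- <-. auto.
  - exfalso. destruct tgt; apply (f_equal snd) in Hhead; cbn in Hhead; lia.
Qed.

Lemma generator_closed p q :
  clos_refl_trans psym (succ_pred rules) p q ->
  (exists i, generator i /\ p = pred1 i) -> exists i, generator i /\ q = pred1 i.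
Proof.
  induction 1 as [p q (r & xs & Hr & Hhead & Hin)| |]; auto.
  intros (i & Hi & ->).
  destruct (generator_rule r i Hr Hhead Hi) as (l & [-> | ->]); cbn in Hin.
  - destruct Hin as [Hin|[Hin|[]]]; [discriminate|]. injection Hin as <- _.
    exists Words. split; [now right | reflexivity].
  - destruct Hin as [Hin|[]]. discriminate.
Qed.

Lemma generator_connected r i :
  In r rules -> rhead r = pred1 i -> generator i -> connected r.
Proof.
  intros Hr Hhead Hi.
  destruct (generator_rule r i Hr Hhead Hi) as (l & [-> | ->]); do 4 eexists;
    (split; [reflexivity|]; split; [apply Permutation_refl|]); cbn [rrest]; split.
  - intros a [<-|[]]. intros [].
  - intros q us [H|[]]. injection H as <- <-. do 2 eexists. split; [reflexivity | now left].
  - intros a [].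
  - intros q us [].
Qed.

End Rules.

(** * The entailment problem of a machine *)

Section Instance.

Context (kappa : nat).
Context (T : list trans) (K : nat) (qf : nat).

Local Notation N := (alphabet_size T K).
Local Notation rules := (rules kappa T K qf).
Local Notation cell := (cell kappa).
Local Notation segment := (segment kappa).

(** The skip in front of the compiled program makes this the only transition out of state 0, so phi
    can write the first letter of the run in advance. *)
Definition start_trans : trans := (0, EKeep, 1).

(** A pair is at least its first component, so these variables avoid those of the rules; and a
    program computes them by a single pairing. *)
Definition chain_var (i : nat) : var := cpair (5 + N) i.

(** The last cell is the outermost conjunct, so the code for [S i] arises from [i] and the code for
    [i], which is the pattern of [RPrec]. *)
Fixpoint chain (n : nat) : form :=
  match n with
  | 0 => FAtom (cell 0 (TVar (chain_var 0)) (Tr start_trans))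
  | S i => FStar (FAtom (cell (chain_var i) (TVar (chain_var (S i))) (Rg 0))) (chain i)
  end.

(** [Start] insists on a transition as its first letter, which ends the input block after exactly
    [n] letters. *)
Definition phi (n : nat) : form := FStar (FAtom (call1 T K Start (chain_var n))) (chain n).
Definition psi : form := FAtom (call1 T K Scan 0).

Lemma phi_psi_restricted n :
  2 <= kappa -> restricted_instance kappa (phi n) psi rules.
Proof.
  intros Hkappa.
  assert (Hp : forall q, in_P rules (phi n) q -> exists i, generator i /\ q = pred1 T K i).
  { intros q (p & Hp & Hpq). apply (generator_closed kappa T K qf p q Hpq).
    assert (Hc : preds_form (chain n) = []) by (induction n; auto).
    cbn [phi preds_form call1] in Hp. rewrite Hc in Hp. destruct Hp as [<-|[]].
    exists Start. split; [now left | reflexivity]. }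
  split; [|split; [|split; [|split; [|split; [|split; [|split; [|split]]]]]]].
  - split; [apply call1_wf|]. clear Hp.
    induction n; [now apply cell_wf | split; [now apply cell_wf | assumption]].
  - apply call1_wf.
  - now apply rules_wf.
  - split; [exact I|]. clear Hp. induction n; [exact I | split; [exact I | assumption]].
  - intros r Hr _. now apply rules_progressing with kappa T K qf.
  - intros r Hr _. now apply rules_progressing with kappa T K qf.
  - intros r Hr Hin. apply Hp in Hin as (i & Hi & Hhead).
    now apply (generator_connected kappa T K qf) with i.
  - intros r Hr _. now apply rules_established.
  - intros r Hr _. now apply rules_established.
Qed.

Context (HK : forall t r, In t T -> uses (act t) r -> r < K).
Context (HK0 : 0 < K).
Context (Hstart : In start_trans T).

Definition first_block (n : nat) : list letter := Tr start_trans :: map Rg (repeat 0 n).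

Lemma chain_meaning s ps n : forall h,
  map s (letter_vars T K) = map Some ps -> meaning kappa T K qf s h (chain n) ->
  exists x y, s 0 = Some x /\ s (chain_var n) = Some y /\
    segment (value_of ps) x (first_block n) y h.
Proof.
  induction n as [|n IH]; intros h Hps Hm; cbn [chain meaning] in Hm.
  - apply (cell_meaning kappa T K qf _ _ _ _ _ ps) in Hm as (a & b & Ha & Hb & ->); auto.
    2: now apply in_letters_Tr.
    exists a, b. repeat split; auto. exists b, hempty.
    split; [now apply hunion_empty_r | now split].
  - destruct Hm as (h1 & h2 & Hu & H1 & H2).
    apply (cell_meaning kappa T K qf _ _ _ _ _ ps) in H1 as (a & b & Ha & Hb & ->); auto.
    2: now apply in_letters_Rg.
    apply IH in H2 as (x & y & Hx & Hy & Hseg); [|assumption].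
    rewrite Ha in Hy. injection Hy as <-. exists x, b. repeat split; auto.
    unfold first_block in *. replace (S n) with (n + 1) by lia.
    rewrite repeat_app, map_app, app_comm_cons. apply segment_app.
    exists a, h2, (cell_heap a (cell_value kappa (value_of ps) b (Rg 0))).
    split; [now apply hunion_comm|]. split; [assumption|].
    exists b, hempty. split; [now apply hunion_empty_r | now split].
Qed.

Lemma phi_meaning s h n :
  sat rules s h (phi n) ->
  exists ps x t X, map s (letter_vars T K) = map Some ps /\ s 0 = Some x /\
    In t T /\ closed_word T K X /\
    segment (value_of ps) x (first_block n ++ Tr t :: X) lbot h.
Proof.
  intros Hsat. apply (sat_meaning kappa) in Hsat.
  destruct Hsat as (h1 & h2 & Hu & H1 & H2).
  assert (exists y ps, s (chain_var n) = Some y /\ map s (letter_vars T K) = map Some ps)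
    as (y & ps & Hy & Hps).
  { destruct H1 as (ls & Hls & _). destruct ls as [|y ps]; [discriminate|].
    injection Hls as Hy Hps. eauto. }
  apply (call1_meaning kappa T K qf _ _ _ _ y ps) in H1 as (W & HW & Hseg); auto.
  apply (proj1 (acc_sound T K qf)) in HW as (t & X & -> & Ht & HX).
  apply (chain_meaning s ps) in H2 as (x & y' & Hx & Hy' & Hseg'); [|assumption].
  rewrite Hy in Hy'. injection Hy' as <-.
  exists ps, x, t, X. repeat split; auto. apply segment_app. exists y, h2, h1.
  split; [now apply hunion_comm|]. auto.
Qed.

Lemma closed_word_app u W :
  Forall (fun a => a < K) u -> closed_word T K W -> closed_word T K (map Rg u ++ W).
Proof. induction 1; cbn; auto. constructor; auto. now apply in_inner_Rg. Qed.

Lemma input_block n : Forall (fun a => a < K) (repeat 0 n).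
Proof. apply Forall_forall. intros a Ha. apply repeat_spec in Ha. now subst. Qed.

Lemma count_input n m : count (repeat 0 n) m = input_regs n m.
Proof.
  unfold input_regs, upd. destruct (Nat.eqb_spec m 0) as [->|Hm].
  - now apply count_occ_repeat_eq.
  - apply count_occ_repeat_neq. auto.
Qed.

Lemma letter_values_value_of ps : length ps = N -> letter_values T K (value_of ps) = ps.
Proof.
  intros H. unfold letter_values, value_of. apply nth_ext with 1 1.
  - now rewrite length_map, length_seq.
  - intros i Hi. rewrite length_map, length_seq in Hi.
    rewrite (nth_indep _ 1 (nth 0 ps 1)) by now rewrite length_map, length_seq.
    rewrite (map_nth (fun n => nth n ps 1)), seq_nth by assumption. reflexivity.
Qed.

Lemma letter_values_length (s : store) ps : map s (letter_vars T K) = map Some ps -> length (ps : list loc) = N.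
Proof.
  intros H. apply (f_equal (@length (option loc))) in H. rewrite !length_map in H.
  now rewrite <- H, letter_vars_length.
Qed.

Lemma not_accepting_entails n :
  (forall s, ~ steps T 0 (input_regs n) qf s) -> entails kappa rules (phi n) psi.
Proof.
  intros Hno s h Hs (Hb & _ & _) Hsat.
  apply phi_meaning in Hsat as (ps & x & t & X & Hps & Hx & Ht & HX & Hseg).
  assert (Hlv : forall k, value_of ps k <> lbot).
  { intros k. unfold value_of. destruct (nth_in_or_default k ps 1) as [Hin| ->]; [|discriminate].
    apply (in_map Some) in Hin. rewrite <- Hps in Hin. apply in_map_iff in Hin as (v & Hv & _).
    now apply Hs in Hv. }
  unfold first_block in Hseg. cbn [app] in Hseg.
  assert (HX' : closed_word T K (map Rg (repeat 0 n) ++ Tr t :: X)).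
  { apply closed_word_app; [apply input_block|]. constructor; [now apply in_inner_Tr | assumption]. }
  destruct (scan_or_valid T K qf HK (S (length (map Rg (repeat 0 n) ++ Tr t :: X)))
    start_trans (map Rg (repeat 0 n) ++ Tr t :: X)) as [Hscan|Hvalid]; auto.
  - apply (proj1 (acc_sat kappa T K qf (value_of ps) Hlv) _ _ Hscan s h x); auto.
    cbn [map]. rewrite Hx, Hps, letter_values_value_of; [reflexivity|].
    now apply letter_values_length with s.
  - exfalso. apply valid_steps in Hvalid as [s' Hvalid]. apply (Hno s').
    replace (input_regs n) with (fun m => count_block m (map Rg (repeat 0 n) ++ Tr t :: X)); auto.
    apply functional_extensionality. intros m.
    rewrite count_block_app, count_input. cbn. lia.
Qed.

(** * A model with pairwise distinct letters *)

(** Location 0 is [lbot], 1 is the default of [value_of], and 2 to [N + 1] are the letters; the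
    cells come after them. *)
Definition root : loc := N + 2.

Definition model_store : store := fun v =>
  if v <? 5 then Some root
  else if v <? 5 + N then Some (v - 3)
  else Some (1 + root + snd (Cantor.of_nat v)).

Lemma model_store_valid : valid_store model_store.
Proof.
  intros v l. unfold model_store, root, lbot.
  destruct (Nat.ltb_spec v 5); [|destruct (v <? 5 + N)]; intros [= <-]; lia.
Qed.

Lemma model_store_chain i : model_store (chain_var i) = Some (1 + root + i).
Proof.
  pose proof (cpair_ge_l (5 + N) i). unfold model_store. unfold chain_var at 1 2.
  destruct (Nat.ltb_spec (cpair (5 + N) i) 5); [lia|].
  destruct (Nat.ltb_spec (cpair (5 + N) i) (5 + N)); [lia|].
  unfold chain_var. rewrite cpair_to_nat, Cantor.cancel_of_to. reflexivity.
Qed.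

Definition model_letters : list loc := letter_values T K (fun n => 2 + n).

Lemma model_letters_length : length model_letters = N.
Proof. unfold model_letters, letter_values. now rewrite length_map, length_seq. Qed.

Lemma model_store_letters : map model_store (letter_vars T K) = map Some model_letters.
Proof.
  unfold model_letters, letter_values, letter_vars. rewrite !map_map. apply map_ext_in.
  intros n Hn. apply in_seq in Hn. unfold model_store.
  destruct (Nat.ltb_spec (5 + n) 5); [lia|]. destruct (Nat.ltb_spec (5 + n) (5 + N)); [reflexivity | lia].
Qed.

Lemma model_letters_value n : value_of model_letters n = if n <? N then 2 + n else 1.
Proof.
  unfold value_of. destruct (Nat.ltb_spec n N) as [Hn|Hn].
  - unfold model_letters, letter_values.
    rewrite (nth_indep _ 1 (2 + 0)) by now rewrite length_map, length_seq.
    now rewrite (map_nth (fun n => 2 + n)), seq_nth.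
  - apply nth_overflow. now rewrite model_letters_length.
Qed.

Context (Hkappa : 2 <= kappa).

(** Intervals give the disjointness of adjacent pieces, the finiteness of the heap, and a free
    [lbot] because [root] is positive. *)
Definition located (a b : nat) (h : heap) : Prop :=
  forall l v, h l = Some v -> a <= l < b /\ length v = kappa.

Lemma cell_heap_located lv a y l : located a (S a) (cell_heap a (cell_value kappa lv y l)).
Proof.
  intros k v. unfold cell_heap. destruct (Nat.eqb_spec k a); intros [= <-].
  split; [lia|]. cbn. rewrite repeat_length. lia.
Qed.

Lemma hplus_located a b c h1 h2 :
  a <= b <= c -> located a b h1 -> located b c h2 ->
  hunion h1 h2 (hplus h1 h2) /\ located a c (hplus h1 h2).
Proof.
  intros Hle H1 H2. split.
  - apply hunion_plus. intros l.
    destruct (h1 l) eqn:E1; [|now left]. destruct (h2 l) eqn:E2; [|now right].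
    apply H1 in E1. apply H2 in E2. lia.
  - intros l v. unfold hplus. destruct (h1 l) eqn:E1.
    + intros [= <-]. apply H1 in E1. intuition lia.
    + intros E2. apply H2 in E2. intuition lia.
Qed.

Lemma segment_exists lv W : forall a, W <> [] ->
  exists h, segment lv a W lbot h /\ located a (a + length W) h.
Proof.
  induction W as [|l W IH]; intros a HW; [contradiction|].
  destruct W as [|l' W].
  - exists (cell_heap a (cell_value kappa lv lbot l)). split.
    + exists lbot, hempty. split; [now apply hunion_empty_r | now split].
    + replace (a + length [l]) with (S a) by (cbn; lia). apply cell_heap_located.
  - destruct (IH (S a)) as (h & Hseg & Hloc); [discriminate|].
    destruct (hplus_located a (S a) (S a + length (l' :: W))
      (cell_heap a (cell_value kappa lv (S a) l)) h) as [Hu Hloc'];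
      [lia | apply cell_heap_located | assumption |].
    eexists. split; [exists (S a), h; eauto|].
    replace (a + length (l :: l' :: W)) with (S a + length (l' :: W)) by (cbn; lia). exact Hloc'.
Qed.

Lemma model_store_letter l :
  In l (letters T K) -> model_store (letter_var l) = Some (value_of model_letters (index l)).
Proof. apply letter_var_value. apply model_store_letters. Qed.

Lemma chain_model n :
  exists h, sat rules model_store h (chain n) /\ located root (1 + root + n) h.
Proof.
  induction n as [|n (h & Hsat & Hloc)].
  - eexists. split.
    + apply (sat_cell kappa T K qf (value_of model_letters));
        [reflexivity | apply model_store_chain |].
      apply model_store_letter. now apply in_letters_Tr.
    + rewrite Nat.add_0_r. apply cell_heap_located.
  - destruct (hplus_located root (1 + root + n) (1 + root + S n) h
      (cell_heap (1 + root + n)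
        (cell_value kappa (value_of model_letters) (1 + root + S n) (Rg 0)))) as [Hu Hloc'];
      [lia | assumption | |].
    { replace (1 + root + S n) with (S (1 + root + n)) at 1 by lia. apply cell_heap_located. }
    eexists. split; [|exact Hloc']. eapply sat_star; [apply hunion_comm, Hu | | exact Hsat].
    apply sat_cell; [apply model_store_chain | apply model_store_chain |].
    apply model_store_letter. now apply in_letters_Rg.
Qed.

Lemma closed_word_letters W : closed_word T K W -> Forall (fun l => In l (letters T K)) W.
Proof. induction 1; constructor; auto; [now left | now right]. Qed.

Context (Hstart_unique : forall t, In t T -> src t = 0 -> t = start_trans).
Context (Hqf : 1 < qf).

Lemma accepting_word n s :
  steps T 0 (input_regs n) qf s ->
  exists t X, In t T /\ closed_word T K X /\
    valid T qf 0 (input_regs n) (first_block n ++ Tr t :: X).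
Proof.
  intros Hst.
  destruct (steps_valid T K qf HK _ _ _ _ Hst eq_refl) as [Hv|(t & s1 & W & Ht & Hsrc & HW & Hv' & Hv)].
  - intros r Hr. unfold input_regs. upd_simpl. reflexivity.
  (* The run is not empty, as [qf] is not 0. *)
  - inversion Hv. lia.
  - apply Hstart_unique in Hsrc; [|assumption]. subst t.
    assert (Hblock : block K (input_regs n) = repeat 0 n).
    { unfold block. replace K with (S (K - 1)) by lia. generalize (K - 1) as k. intros k.
      cbn [seq flat_map].
      replace (flat_map _ (seq 1 k)) with (@nil nat); [now rewrite app_nil_r|].
      assert (Hz : forall a, 0 < a ->
        flat_map (fun m => repeat m (input_regs n m)) (seq a k) = []).
      { clear. induction k as [|k IH]; intros [|a] Ha; [lia | reflexivity | lia |].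
        cbn. apply IH. lia. }
      symmetry. apply Hz. lia. }
    (* Since [qf] is not 1 either, a second configuration follows, as phi demands. *)
    rewrite Hblock in Hv. inversion Hv'; subst; [cbn in *; lia|].
    apply closed_word_inv in HW as [Ht' HX]. eauto.
Qed.

Lemma accepting_not_entails n s :
  steps T 0 (input_regs n) qf s -> ~ entails kappa rules (phi n) psi.
Proof.
  intros Hst Hent.
  destruct (accepting_word n s Hst) as (t & X & Ht & HX & Hvalid).
  destruct (chain_model n) as (h2 & Hsat2 & Hloc2).
  destruct (segment_exists (value_of model_letters) (Tr t :: X) (1 + root + n))
    as (h1 & Hseg1 & Hloc1); [discriminate|].
  destruct (hplus_located _ _ _ _ _ (conj (Nat.le_trans _ _ _ (le_S _ _ (le_n root)) (Nat.le_add_r _ _)) (Nat.le_add_r _ _)) Hloc2 Hloc1)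
    as [Hu Hloc].
  set (h := hplus h2 h1) in *.
  assert (Hb : h lbot = None).
  { destruct (h lbot) eqn:E; [|reflexivity]. apply Hloc in E. unfold root, lbot in E. lia. }
  assert (Hlv : forall k, value_of model_letters k <> lbot).
  { intros k. rewrite model_letters_value. unfold lbot. destruct (k <? N); lia. }
  assert (Hphi : sat rules model_store h (phi n)).
  { eapply sat_star; [apply hunion_comm, Hu | | exact Hsat2].
    apply (proj1 (acc_sat kappa T K qf _ Hlv) Start (Tr t :: X)) with (1 + root + n).
    - now apply start_complete.
    - assumption.
    - apply (hunion_none _ _ _ _ Hu Hb).
    - cbn [map]. rewrite model_store_chain, model_store_letters.
      rewrite letter_values_value_of; [reflexivity | apply model_letters_length]. }
  assert (Hpsi : sat rules model_store h psi).
  { apply Hent; [apply model_store_valid | | assumption]. split; [assumption|]. split.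
    - eexists. intros l Hl. destruct (h l) eqn:E; [|reflexivity]. apply Hloc in E.
      exfalso. apply (Nat.lt_irrefl l). eapply Nat.lt_le_trans; [apply E | exact Hl].
    - intros l v E. now apply Hloc in E. }
  destruct (chain_meaning model_store model_letters n h2) as (x & y & Hx & Hy & Hseg2);
    [apply model_store_letters | now apply sat_meaning |].
  rewrite model_store_chain in Hy. injection Hy as <-. injection Hx as <-.
  assert (Hseg : segment (value_of model_letters) root (first_block n ++ Tr t :: X) lbot h).
  { apply segment_app. eauto 6. }
  apply (sat_meaning kappa) in Hpsi.
  apply (call1_meaning kappa T K qf _ _ _ _ root model_letters) in Hpsi as (W & HW & HsegW);
    [|apply model_store_letters | reflexivity].
  (* The word in which psi finds an error is spelled by the same heap from the same location, so it
     is the run itself. *)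
  assert (first_block n ++ Tr t :: X = W) as <-.
  { eapply segment_unique; [| exact Hseg | exact HsegW | congruence | assumption | assumption].
    intros l l' Hl. rewrite !model_letters_value.
    assert (Hin : In l (letters T K)).
    { assert (Hcl : closed_word T K (first_block n ++ Tr t :: X)).
      { constructor; [now apply in_inner_Tr|]. apply closed_word_app; [apply input_block|].
        constructor; [now apply in_inner_Tr | assumption]. }
      apply closed_word_letters in Hcl. rewrite Forall_forall in Hcl. auto. }
    apply index_lt in Hin. destruct (Nat.ltb_spec (index l) N); [|lia].
    destruct (index l' <? N); intros E; [|lia]. apply index_inj. lia. }
  apply (proj1 (acc_sound T K qf)) in HW as (A & t' & X' & HA & Herr).
  exact (valid_no_error T K qf _ _ _ _ _ _ Hvalid HA Herr).
Qed.

End Instance.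

(** * Computing the encoding of a problem *)

Section Template.

(* The parameters are the codes of the parts of the problem that do not depend
   on the input [n]; see [enc_instance]. *)
Context (b k0 k1 kp k2 k3 : nat).

Definition template : nat :=
  cpair b (cpair k0 (cpair k1 (cpair kp (cpair k2 k3)))).

Fixpoint chain_code (n : nat) : nat :=
  match n with
  | 0 => k1
  | S i =>
      cpair 1 (cpair
        (cpair 0 (cpair 2 (cpair (cpair b i) (S (cpair (cpair 0 (cpair b (S i))) k0)))))
        (chain_code i))
  end.

Definition instance_code (n : nat) : nat :=
  cpair (cpair 1 (cpair
           (cpair 0 (cpair 3 (cpair kp (S (cpair (cpair b n) k2)))))
           (chain_code n)))
        k3.

End Template.

Fixpoint const_prog (n : nat) : rprog :=
  match n with 0 => RZero | S n => RComp RSucc (const_prog n) end.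

Lemma const_prog_eval n x : reval (const_prog n) x n.
Proof. induction n; econstructor; eauto using reval. Qed.

Definition tagged (tag : nat) (f : rprog) : rprog := RPair (const_prog tag) f.

Lemma tagged_eval tag f x v : reval f x v -> reval (tagged tag f) x (cpair tag v).
Proof. intros. apply ev_pair; [apply const_prog_eval | assumption]. Qed.

Fixpoint field (i : nat) : rprog :=
  match i with 0 => RFst | S i => RComp (field i) RSnd end.

(* On [cpair t (cpair i w)]: [t] is a template, [i] the counter and [w] the code
   of the chain of length [i]. *)
Definition chain_step : rprog :=
  let base := RComp (field 0) RFst in
  let value := RComp (field 1) RFst in
  let counter := RComp RFst RSnd in
  tagged 1 (RPair
    (tagged 0 (tagged 2 (RPair (RPair base counter)
      (RComp RSucc (RPair (tagged 0 (RPair base (RComp RSucc counter))) value)))))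
    (RComp RSnd RSnd)).

(** The diagonal lies in the occurrences of [RId]: the template itself is used as the input [n], in
    the variable at the end of the chain and, in [RPair RId RId], as the length of the chain. *)
Definition diagonal_prog : rprog :=
  RPair (tagged 1 (RPair
    (tagged 0 (tagged 3 (RPair (field 3) (RComp RSucc (RPair (RPair (field 0) RId) (field 4))))))
    (RComp (RPrec (field 2) chain_step) (RPair RId RId))))
  (RComp RSnd (RComp RSnd (RComp RSnd (RComp RSnd RSnd)))).

Ltac run :=
  repeat first [ apply tagged_eval | apply ev_pair | apply ev_succ | apply ev_id
               | apply ev_fst | apply ev_snd | eapply ev_comp ].

Lemma chain_prog_eval b k0 k1 kp k2 k3 n :
  reval (RPrec (field 2) chain_step) (cpair (template b k0 k1 kp k2 k3) n)
        (chain_code b k0 k1 n).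
Proof.
  induction n as [|n IH].
  - apply ev_prec0. unfold template. cbn [field chain_code]. run.
  - eapply ev_precS; [exact IH|]. unfold chain_step, template. cbn [field chain_code]. run.
Qed.

Lemma diagonal_prog_eval b k0 k1 kp k2 k3 :
  let q := template b k0 k1 kp k2 k3 in
  reval diagonal_prog q (instance_code b k0 k1 kp k2 k3 q).
Proof.
  cbv zeta. unfold diagonal_prog, instance_code. apply ev_pair.
  - apply tagged_eval, ev_pair.
    + unfold template. cbn [field]. run.
    + eapply ev_comp; [run | apply chain_prog_eval].
  - unfold template. run.
Qed.

Lemma enc_instance kappa T K qf :
  exists b k0 k1 kp k2 k3, forall n,
    enc_problem (phi kappa T K n) (psi T K) (rules kappa T K qf) =
    instance_code b k0 k1 kp k2 k3 n.
Proof.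
  exists (5 + alphabet_size T K),
    (enc_list enc_term (TVar (letter_var (Rg 0)) :: repeat TBot (kappa - 2))),
    (enc_form (chain kappa T K 0)), (enc_psym (pred1 T K Start)),
    (enc_list (fun x => x) (letter_vars T K)),
    (cpair (enc_form (psi T K)) (enc_list enc_rule (rules kappa T K qf))).
  intros n. unfold enc_problem, instance_code. f_equal.
  cbn [phi enc_form]. do 2 f_equal. induction n as [|n IH]; [reflexivity|].
  cbn [chain chain_code enc_form]. now rewrite IH.
Qed.

(** * The machine of the diagonal program and the contradiction *)

Definition reg_of (t : trans) : nat :=
  match act t with EKeep => 0 | EInc r | EDec r | EZero r => r end.

Definition reg_bound (T : list trans) : nat := S (list_max (map reg_of T)).

Lemma uses_reg_bound T t r : In t T -> uses (act t) r -> r < reg_bound T.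
Proof.
  intros Ht Hr. unfold reg_bound.
  assert (H : Forall (fun k => k <= list_max (map reg_of T)) (map reg_of T))
    by now apply list_max_le.
  rewrite Forall_forall in H. specialize (H _ (in_map reg_of _ _ Ht)).
  assert (reg_of t = r) as <- by (unfold reg_of; now destruct (act t)). lia.
Qed.

Lemma machine_start f : In start_trans (machine f).
Proof. apply in_app_iff. left. now left. Qed.

Lemma machine_start_unique f t : In t (machine f) -> src t = 0 -> t = start_trans.
Proof.
  intros Ht Hsrc. destruct t as [[q e] q']. cbn in Hsrc. subst q.
  destruct (machine_deterministic f _ _ _ _ _ Ht (machine_start f))
    as [[-> ->]|(r & [[_ H]|[_ H]])]; [reflexivity | discriminate | discriminate].
Qed.

Lemma final_state_gt f : 1 < final_state f.
Proof. unfold final_state, test_state. pose proof (size_pos (machine_cmd f)). lia. Qed.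

Theorem theorem2 (kappa : nat) (Hkappa : 2 <= kappa) :
  ~ exists P : rprog, decides_restricted_entailment kappa P.
Proof.
  intros [P HP].
  set (f := RComp P diagonal_prog).
  set (T := machine f). set (K := reg_bound T). set (qf := final_state f).
  destruct (enc_instance kappa T K qf) as (b & k0 & k1 & kp & k2 & k3 & Henc).
  set (q := template b k0 k1 kp k2 k3).
  assert (Hf : forall v, reval P (enc_problem (phi kappa T K q) (psi T K) (rules kappa T K qf)) v ->
    reval f q v).
  { intros v Hv. eapply ev_comp; [apply diagonal_prog_eval|]. now rewrite <- Henc. }
  destruct (HP _ _ _ (phi_psi_restricted kappa T K qf q Hkappa)) as [Hyes Hno].
  assert (HK : forall t r, In t T -> uses (act t) r -> r < K) by apply uses_reg_bound.
  assert (HK0 : 0 < K) by apply Nat.lt_0_succ.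
  assert (Hstart : In start_trans T) by apply machine_start.
  assert (Hnot : ~ entails kappa (rules kappa T K qf) (phi kappa T K q) (psi T K)).
  { intros Hent. destruct (machine_accepts f q (Hf _ (Hyes Hent))) as [s Hs].
    revert Hent. apply accepting_not_entails with s; try assumption.
    - apply machine_start_unique.
    - apply final_state_gt. }
  apply Hnot. apply not_accepting_entails; try assumption.
  intros s. apply machine_rejects. auto.
Qed.
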